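(* (i) A non-trapezoidal convex quadrangle admits a $3$-self-affinity based on a glass-cut dissection of combinatorial type $\mathcal A$ if and only if it is of an affine type $Q[x,y]$ with $(x,y)$ in $\mathbf A=\{(x,y): x+y>1,\ y<1,\ x<y,\ y^3+xy^2-x^2-y^2=0\}$. (ii) A non-trapezoidal convex quadrangle admits a $3$-self-affinity based on a glass-cut dissection of combinatorial type $\mathcal B$ if and only if it is of an affine type $Q[x,y]$ with $(x,y)$ in one of the two families $\mathbf B_1=\{(x,y): x+y>1,\ y<1,\ x<y,\ (x+1)y^2-(x+1)y+x(1-x)=0\}$ or $\mathbf B_2=\{(x,y): x+y>1,\ y<1,\ x<y,\ x^3+(-y^2+y-2)x^2+(-y^3+2y^2-y+1)x+y^2-y=0\}$.
   Context: A convex quadrangle is of affine type $Q[x,y]$ if an affine map sending three consecutive vertices to $\binom01,\binom00,\binom10$ sends the fourth to $\binom xy$ (then $x,y>0$, $x+y>1$). A trapezoid is a convex quadrangle with a pair of parallel sides. A $3$-self-affinity of $Q$ is a dissection of $Q$ into three affine images of $Q$ (union is $Q$, interiors pairwise disjoint). A glass-cut dissection is obtained by successively cutting a piece into two along a straight segment joining two of its boundary points. Type $\mathcal A$: $Q$ is cut by two disjoint segments, each joining a relative interior point of a side $a$ to a relative interior point of the opposite side $c$ (same pair $a,c$ for both). Type $\mathcal B$: $Q$ is cut by a segment $s$ joining relative interior points of two opposite sides into two quadrangles, and one of these is further cut by a segment joining a relative interior point of $s$ to a relative interior point of the side of that quadrangle opposite to $s$. *)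

(* Defs.v *)
From mathcomp Require Import all_boot all_order all_algebra.
From mathcomp Require Import all_classical all_reals all_analysis.

Set Implicit Arguments.
Unset Strict Implicit.
Unset Printing Implicit Defensive.

Import Order.TTheory GRing.Theory Num.Theory.
Import numFieldNormedType.Exports.

Local Open Scope classical_set_scope.
Local Open Scope ring_scope.

Section Plane.
Variable R : realType.
Implicit Types (a b u v w : 'rV[R]_2) (X Y Z : set 'rV[R]_2).

Definition point (x y : R) : 'rV[R]_2 := \row_(j < 2) (if j == 0 then x else y).

Definition cross a b : R := a 0 0 * b 0 1 - a 0 1 * b 0 0.

(* Twice the signed area of the triangle u v w; its sign tells on which side of
   the line through u and v the point w lies. *)
Definition orient u v w : R := cross (v - u) (w - u).

Definition closed_segment u v : set 'rV[R]_2 :=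
  [set (1 - t) *: u + t *: v | t in `[0, 1]%classic].

Definition open_segment u v : set 'rV[R]_2 :=
  [set (1 - t) *: u + t *: v | t in `]0, 1[%classic].

Definition affine_map (M : 'M[R]_2) b (u : 'rV[R]_2) : 'rV[R]_2 := u *m M + b.

Definition affine_image X Y : Prop :=
  exists (M : 'M[R]_2) b, M \in unitmx /\ Y = affine_map M b @` X.

Definition boundary X : set 'rV[R]_2 := closure X `\` X°.

(* Y and Z are the two parts into which the chord [u, v] cuts X.  For convex X
   (the only case that arises, since the parts are convex again) the line
   through u and v meets X exactly in that chord, so the parts are the
   intersections of X with the two closed half-planes of this line. *)
Definition chord_cut X u v Y Z : Prop :=
  [/\ boundary X u, boundary X v, open_segment u v `<=` X°,
      Y = X `&` [set w | 0 <= orient u v w] &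
      Z = X `&` [set w | orient u v w <= 0]].

(* [glass_cut X cs Ps]: cutting X successively along the segments listed in cs
   leaves the pieces Ps. *)
Inductive glass_cut X :
    seq ('rV[R]_2 * 'rV[R]_2) -> seq (set 'rV[R]_2) -> Prop :=
| glass_cut_nil : glass_cut X [::] [:: X]
| glass_cut_rcons cs Ps Y Qs u v Z1 Z2 :
    glass_cut X cs (Ps ++ Y :: Qs) -> chord_cut Y u v Z1 Z2 ->
    glass_cut X (rcons cs (u, v)) (Ps ++ [:: Z1, Z2 & Qs]).

Definition dissection X (Ps : seq (set 'rV[R]_2)) : Prop :=
  \bigcup_(k in `I_(size Ps)) nth set0 Ps k = X /\
  trivIset `I_(size Ps) (fun k => (nth set0 Ps k)°).

Definition self_affinity (n : nat) X (Ps : seq (set 'rV[R]_2)) : Prop :=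
  [/\ size Ps = n, dissection X Ps &
      forall k, (k < n)%N -> affine_image X (nth set0 Ps k)].

(* Vertices are listed in cyclic order; the index arithmetic below is that of
   the cyclic group 'I_4, so p (i + 1) follows p i, and the side
   p (i + 2) p (i + 3) is opposite to the side p i p (i + 1). *)
Implicit Type p : 'I_4 -> 'rV[R]_2.

(* The two remaining vertices lie strictly on the same side of each side line. *)
Definition convex_quadrangle p : Prop :=
  forall i, 0 < orient (p i) (p (i + 1)) (p (i + 2)) *
                orient (p i) (p (i + 1)) (p (i + 3)).

Definition region p : set 'rV[R]_2 :=
  [set \sum_i t i *: p i |
     t in [set t : 'I_4 -> R | (forall i, 0 <= t i) /\ \sum_i t i = 1]].

(* Relative interior of the side p i p (i + 1). *)
Definition open_side p (i : 'I_4) : set 'rV[R]_2 := open_segment (p i) (p (i + 1)).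

Definition trapezoid p : Prop :=
  exists i, cross (p (i + 1) - p i) (p (i + 3) - p (i + 2)) = 0.

(* The three consecutive vertices may be run through in either direction,
   e being the step 1 or -1. *)
Definition affine_type p (x y : R) : Prop :=
  exists i e (M : 'M[R]_2) b, (e = 1 \/ e = -1) /\ M \in unitmx /\
    [/\ affine_map M b (p i) = point 0 1,
        affine_map M b (p (i + e)) = point 0 0,
        affine_map M b (p (i + e *+ 2)) = point 1 0 &
        affine_map M b (p (i + e *+ 3)) = point x y].

Definition type_A p (Ps : seq (set 'rV[R]_2)) : Prop :=
  exists i u1 v1 u2 v2,
    [/\ open_side p i u1 /\ open_side p (i + 2) v1,
        open_side p i u2 /\ open_side p (i + 2) v2,
        closed_segment u1 v1 `&` closed_segment u2 v2 = set0 &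
        glass_cut (region p) [:: (u1, v1); (u2, v2)] Ps].

(* The segment s = [u1, v1] cuts off the quadrangles u1 p_(i+1) p_(i+2) v1 and
   v1 p_(i+3) p_i u1, whose sides opposite to s are the sides of p of index
   i + 1 and i + 3. The second cut starts on s and ends on one of these; as its
   end points must lie on the boundary of the piece being cut, that piece is the
   corresponding quadrangle. *)
Definition type_B p (Ps : seq (set 'rV[R]_2)) : Prop :=
  exists i u1 v1 u2 v2,
    [/\ open_side p i u1 /\ open_side p (i + 2) v1,
        open_segment u1 v1 u2,
        open_side p (i + 1) v2 \/ open_side p (i + 3) v2 &
        glass_cut (region p) [:: (u1, v1); (u2, v2)] Ps].

End Plane.

Definition curve_A (R : realType) : set (R * R) :=
  [set z | let: (x, y) := z in
     [/\ 1 < x + y, y < 1, x < y &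
         y ^+ 3 + x * y ^+ 2 - x ^+ 2 - y ^+ 2 = 0]].

Definition curve_B1 (R : realType) : set (R * R) :=
  [set z | let: (x, y) := z in
     [/\ 1 < x + y, y < 1, x < y &
         (x + 1) * y ^+ 2 - (x + 1) * y + x * (1 - x) = 0]].

Definition curve_B2 (R : realType) : set (R * R) :=
  [set z | let: (x, y) := z in
     [/\ 1 < x + y, y < 1, x < y &
         x ^+ 3 + (- y ^+ 2 + y - 2) * x ^+ 2
           + (- y ^+ 3 + 2 * y ^+ 2 - y + 1) * x + y ^+ 2 - y = 0]].

(* Main.v *)
(** Let a, b, c, d be the areas of the triangles DAB, ABC, BCD, CDA of a convex
quadrangle ABCD, so that a + c = b + d. Up to scaling and dihedral relabelling
they determine the affine type: Q[x,y] has areas x, 1, y, s with s = x + y - 1,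
and for a non-trapezoid one may label so that b is the largest area, that is
x, y < 1. Let AB and CD meet in O. The pair (OA / OB, OD / OC) = (d / c, a / b)
is multiplicative when ABCD is cut by a segment from AB to CD. For Q[x,y] it is
(s / y, x), and the pairs with entries below 1 that an affine image of Q[x,y]
can have are (s / y, x), (s / x, y) and their transposes. A proper piece cannot
have the pair (s / y, x) or its transpose, since s / y < x.

In type A the three pairs multiply to (s / y, x), which forces two pieces with
pair (s / x, y) and one with its transpose, and amounts to x^2 = s y^2.

In type B, the piece cut off first cannot have the pair (s / x, y), as the rest
would be a trapezoid and its two parts as well. So it has the pair (y, s / x),
and the rest has the pair (L, M) = (s / y^2, x^2 / s), which is possible only if
x^2 < s < y^2. Along the other two sides the rest has ratios
(M (1 - L) / (L (1 - M)), (1 - L) / (1 - M)), which must be the product of two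
inverse pairs. Comparing the entries leaves 1 / x^2, 1 / (x y) and 1 / y^2 for
(1 - L) / (1 - M); these give B1, B2, and a contradiction. *)
Require Import Defs.
From mathcomp Require Import all_boot all_order all_algebra.
From mathcomp Require Import all_classical all_reals all_analysis.
From mathcomp Require Import ring lra.

Set Implicit Arguments.
Unset Strict Implicit.
Unset Printing Implicit Defensive.

Import Order.TTheory GRing.Theory Num.Theory.
Import numFieldNormedType.Exports.

Local Open Scope classical_set_scope.
Local Open Scope ring_scope.

(** * Quadrangles as convex hulls and as intersections of half-planes *)

Section Hull.
Variable R : realType.
Implicit Types (A B C D E F u v w z : 'rV[R]_2) (s t r k : R).

Lemma point_eq u v : u 0 0 = v 0 0 -> u 0 1 = v 0 1 -> u = v.
Proof.
move=> h0 h1; apply/rowP => j.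
by case: j => [[|[|//]] hj]; [move: h0|move: h1]; congr (_ = _); congr (_ _ _); apply: val_inj.
Qed.

Lemma orientE A B C : orient A B C =
  (B 0 0 - A 0 0) * (C 0 1 - A 0 1) - (B 0 1 - A 0 1) * (C 0 0 - A 0 0).
Proof. by rewrite /orient /cross !mxE. Qed.

Local Opaque orient.

(** Four named coefficients take the place of a function on ['I_4]: rotating or reversing the
    vertices then merely permutes the witnesses. *)
Definition hull A B C D : set 'rV[R]_2 :=
  [set w | exists a b c d : R, [/\ [/\ 0 <= a, 0 <= b, 0 <= c & 0 <= d],
     a + b + c + d = 1 & w = a *: A + b *: B + c *: C + d *: D]].

(* The sign of [s] records the orientation of the quadrangle. *)
Definition cvx s A B C D :=
  [/\ 0 < s * orient D A B, 0 < s * orient A B C,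
      0 < s * orient B C D & 0 < s * orient C D A].

Lemma cvx_rot s A B C D : cvx s A B C D -> cvx s B C D A.
Proof. by case=> *; split. Qed.

Lemma orientC A B C : orient C B A = - orient A B C.
Proof. by rewrite !orientE; ring. Qed.

Lemma orient_rot A B C : orient B C A = orient A B C.
Proof. by rewrite !orientE; ring. Qed.

Lemma orient_comb A B C D t :
  orient A B ((1 - t) *: C + t *: D) = (1 - t) * orient A B C + t * orient A B D.
Proof. by rewrite !orientE !mxE; ring. Qed.

Lemma orient_comb4 E F A B C D (a b c d : R) : a + b + c + d = 1 ->
  orient E F (a *: A + b *: B + c *: C + d *: D) =
    a * orient E F A + b * orient E F B + c * orient E F C + d * orient E F D.
Proof.
move=> h1; have -> : a = 1 - b - c - d by rewrite -h1; ring.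
by rewrite !orientE !mxE; ring.
Qed.

Lemma orientAAB A B : orient A A B = 0.
Proof. by rewrite orientE; ring. Qed.

Lemma orientABA A B : orient A B A = 0.
Proof. by rewrite orientE; ring. Qed.

Lemma orientABB A B : orient A B B = 0.
Proof. by rewrite orientE; ring. Qed.

Lemma cvx_rev s A B C D : cvx s A B C D -> cvx (- s) D C B A.
Proof.
by case=> *; split; rewrite orientC mulrNN.
Qed.

Lemma hull_rot A B C D : hull A B C D = hull B C D A.
Proof.
apply/seteqP; split=> w [a [b [c [d [[a0 b0 c0 d0] h ->]]]]].
  exists b, c, d, a; split; [by split|by rewrite -h; ring|].
  by apply: point_eq; rewrite !mxE; ring.
exists d, a, b, c; split; [by split|by rewrite -h; ring|].
by apply: point_eq; rewrite !mxE; ring.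
Qed.

Lemma hull_rev A B C D : hull A B C D = hull D C B A.
Proof.
apply/seteqP; split=> w [a [b [c [d [[a0 b0 c0 d0] h ->]]]]];
  exists d, c, b, a; split; [by split|by rewrite -h; ring|
   by apply: point_eq; rewrite !mxE; ring|by split|by rewrite -h; ring|
   by apply: point_eq; rewrite !mxE; ring].
Qed.

Lemma hull_id1 A B C D : hull A B C D A.
Proof.
exists 1, 0, 0, 0; split; [by split|by rewrite !addr0|].
by apply: point_eq; rewrite !mxE; ring.
Qed.

Lemma hull_vertices A B C D :
  [/\ hull A B C D A, hull A B C D B, hull A B C D C & hull A B C D D].
Proof.
split; [|rewrite hull_rot|rewrite 2!hull_rot|rewrite 3!hull_rot];
  exact: hull_id1.
Qed.

Lemma barycentric A B C w : orient A B C != 0 ->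
  w = (orient B C w / orient A B C) *: A + (orient C A w / orient A B C) *: B
      + (orient A B w / orient A B C) *: C.
Proof.
rewrite !orientE => h.
by apply: point_eq; rewrite !mxE; field.
Qed.

Lemma barycentric_sum A B C w : orient A B C != 0 ->
  orient B C w / orient A B C + orient C A w / orient A B C
      + orient A B w / orient A B C = 1.
Proof. by rewrite !orientE => h; field. Qed.

Lemma divr_scaled_ge0 s (a b : R) : 0 <= s * a -> 0 < s * b -> 0 <= a / b.
Proof.
move=> ha hb.
have hs : s != 0 by apply: contraTneq hb => ->; rewrite mul0r ltxx.
have -> : a / b = (s * a) / (s * b).
  by rewrite -mulf_div divff // mul1r.
by rewrite divr_ge0 // ltW.
Qed.

Lemma gt0_neq0 s (a : R) : 0 < s * a -> a != 0.
Proof. by apply: contraTneq => ->; rewrite mulr0 ltxx. Qed.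

(** A point satisfying the four inequalities lies in one of the two triangles into which the
    diagonal [CA] divides the quadrangle. Its areal coordinates there are quotients of orientations,
    and the remaining coefficient is 0. *)
Lemma hullP s A B C D w : cvx s A B C D ->
  hull A B C D w <-> [/\ 0 <= s * orient A B w, 0 <= s * orient B C w,
                        0 <= s * orient C D w & 0 <= s * orient D A w].
Proof.
case=> ha hb hc hd; split.
  case=> a [b [c [d [[a0 b0 c0 d0] h1 ->]]]].
  rewrite !(orient_comb4 _ _ _ _ _ _ h1) ?(orientAAB, orientABA, orientABB).
  rewrite (orient_rot D A B) (orient_rot A B C) (orient_rot B C D) (orient_rot C D A).
  have pos2 (p q x y : R) : 0 <= p -> 0 <= q -> 0 < s * x -> 0 < s * y ->
      0 <= s * (p * x + q * y).
    by move=> *; rewrite mulrDr !(mulrCA s) addr_ge0 // mulr_ge0 // ltW.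
  by rewrite !(mulr0, addr0, add0r); split; apply: pos2.
case=> h1 h2 h3 h4.
have [hAC|hAC] := lerP 0 (s * orient C A w).
  have b0 : orient A B C != 0 by exact: gt0_neq0 hb.
  exists (orient B C w / orient A B C), (orient C A w / orient A B C),
    (orient A B w / orient A B C), 0; split.
  - by split=> //; exact: (divr_scaled_ge0 (s := s)).
  - by rewrite addr0 barycentric_sum.
  - by rewrite scale0r addr0 -barycentric.
have hd' : 0 < s * orient A C D by rewrite -orient_rot.
have d0 : orient A C D != 0 by exact: gt0_neq0 hd'.
exists (orient C D w / orient A C D), 0, (orient D A w / orient A C D),
    (orient A C w / orient A C D); split.
- split=> //; apply: (divr_scaled_ge0 _ hd') => //.
  by rewrite orient_rot ltW // -oppr_lt0 -mulrN -orientC.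
- by rewrite addr0 barycentric_sum.
- by rewrite scale0r addr0 -barycentric.
Qed.

End Hull.

(** * The two pieces of a cut between opposite sides; topology of half-planes *)

Section Cut.
Variable R : realType.
Implicit Types (A B C D E F u v w z : 'rV[R]_2) (s t r k : R).
Implicit Types X Y Z H K L N : set 'rV[R]_2.

Definition seg t A B : 'rV[R]_2 := (1 - t) *: A + t *: B.

Lemma segC t A B : seg t A B = seg (1 - t) B A.
Proof. by rewrite /seg opprB addrCA subrr addr0 addrC. Qed.

Lemma open_segmentP A B w :
  open_segment A B w <-> exists t, 0 < t < 1 /\ w = seg t A B.
Proof.
by split=> [[t /=]|[t [ht ->]]]; [rewrite in_itv /= => ht <-|];
  exists t => //=; rewrite in_itv.
Qed.

Lemma open_segmentC A B : open_segment A B = open_segment B A.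
Proof.
by apply/seteqP; split=> w /open_segmentP[t [/andP[t0 t1] ->]]; apply/open_segmentP;
  exists (1 - t); rewrite -segC; split=> //; apply/andP; split; lra.
Qed.

(** The second end is parametrised from [D] to [C], so that [t = r = 0] stands for the side [DA] and
    [t = r = 1] for [BC]. The formulas follow from the affinity of [orient] in each argument. *)
Lemma cut_areas A B C D t r (u := seg t A B) (v := seg r D C) :
  [/\ orient D A u = t * orient D A B,
      orient A u v = t * ((1 - r) * orient D A B + r * orient A B C),
      orient u v D = r * ((1 - t) * orient C D A + t * orient B C D) &
      orient v D A = r * orient C D A].
Proof. by rewrite /u /v !orientE !mxE; split; ring. Qed.

Lemma cut_sides A B C D t r w (u := seg t A B) (v := seg r D C) :
  orient A u w = t * orient A B w /\ orient v D w = r * orient C D w.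
Proof. by rewrite /u /v !orientE !mxE; split; ring. Qed.

Local Opaque orient.

Lemma cut_cvx s A B C D t r : cvx s A B C D -> 0 < t < 1 -> 0 < r < 1 ->
  cvx s A (seg t A B) (seg r D C) D.
Proof.
case=> ha hb hc hd /andP[t0 t1] /andP[r0 r1].
have pos2 (p x y : R) : 0 < p < 1 -> 0 < s * x -> 0 < s * y ->
   0 < s * ((1 - p) * x + p * y).
  move=> /andP[p0 p1] hx hy; rewrite mulrDr !(mulrCA s).
  by apply: addr_gt0; apply: mulr_gt0 => //; lra.
case: (cut_areas A B C D t r) => e1 e2 e3 e4.
by split; rewrite ?(e1, e2, e3, e4) mulrCA; apply: mulr_gt0 => //;
  apply: pos2 => //; apply/andP.
Qed.

(** The lines [AB], [CD], [DA] bound both quadrangles, and passing to the piece changes the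
    orientations along them only by the positive factors [t], [r] and 1. *)
Lemma hull_cut s A B C D t r : cvx s A B C D -> 0 < t < 1 -> 0 < r < 1 ->
  hull A (seg t A B) (seg r D C) D =
    hull A B C D `&` [set w | 0 <= s * orient (seg t A B) (seg r D C) w].
Proof.
move=> hc ht hr; have hc' := cut_cvx hc ht hr.
case/andP: ht hr => t0 t1 /andP[r0 r1].
apply/seteqP; split=> w.
  move=> hw; split; last by case/(hullP _ hc'): hw.
  case: hw => a [b [c [d [[a0 b0 c0 d0] h1 ->]]]].
  exists (a + b * (1 - t)), (b * t), (c * r), (c * (1 - r) + d); split.
  - by split; rewrite ?addr_ge0 ?mulr_ge0 //; lra.
  - by rewrite -[RHS]h1; ring.
  - by apply: point_eq; rewrite !mxE; ring.
case=> /(hullP _ hc)[h1 h2 h3 h4] /= h5; apply/(hullP _ hc').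
case: (cut_sides A B C D t r w) => e1 e2.
by split=> //; rewrite ?e1 ?e2 mulrCA mulr_ge0 // ltW.
Qed.

Lemma cvx_swap s A B C D : cvx s A B C D -> cvx (- s) B A D C.
Proof. by move=> h; do 2!apply: cvx_rot; exact: cvx_rev. Qed.

Lemma hull_swap A B C D : hull A B C D = hull B A D C.
Proof. by rewrite hull_rev hull_rot hull_rot. Qed.

(** The mirror relabelling [B A D C] turns the far piece into a near one. It reverses the
    orientation, whence [- s], and replaces the parameters by [1 - t] and [1 - r]. *)
Lemma cut_cvx2 s A B C D t r : cvx s A B C D -> 0 < t < 1 -> 0 < r < 1 ->
  cvx s (seg t A B) B C (seg r D C).
Proof.
move=> hc ht hr; rewrite -[s]opprK; apply: cvx_swap.
rewrite segC (segC r).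
by apply: cut_cvx; [exact: cvx_swap|lra|lra].
Qed.

Lemma hull_cut2 s A B C D t r : cvx s A B C D -> 0 < t < 1 -> 0 < r < 1 ->
  hull (seg t A B) B C (seg r D C) =
    hull A B C D `&` [set w | s * orient (seg t A B) (seg r D C) w <= 0].
Proof.
move=> hc ht hr; rewrite hull_swap [seg t _ _]segC [seg r _ _]segC.
rewrite (hull_cut (cvx_swap hc)); [|lra|lra].
rewrite hull_swap; congr (_ `&` _); apply/seteqP; split=> w /=;
  by rewrite mulNr oppr_ge0.
Qed.

Lemma orient_continuous A B : continuous (fun w => orient A B w).
Proof.
have -> : (fun w => orient A B w) = fun w =>
    (B 0 0 - A 0 0) * (w 0 1 - A 0 1) - (B 0 1 - A 0 1) * (w 0 0 - A 0 0).
  by apply/funext => w; rewrite orientE.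
move=> w.
have c (j : 'I_2) (x : R) : (fun v : 'rV[R]_2 => v 0 j - x) @ w --> w 0 j - x.
  exact: (cvgB (@coord_continuous R 1 2 0 j w) (cvg_cst x)).
have d (j : 'I_2) (x y : R) :
    (fun v : 'rV[R]_2 => y * (v 0 j - x)) @ w --> y * (w 0 j - x).
  exact: (cvgM (cvg_cst y) (c j x)).
exact: (cvgB (d _ _ _) (d _ _ _)).
Qed.

Lemma closed_halfplane s A B : closed [set w | 0 <= s * orient A B w].
Proof.
apply: (@closed_comp _ _ (fun w => s * orient A B w) [set y | 0 <= y]).
  by move=> w _; exact: (cvgM (cvg_cst s) (@orient_continuous A B w)).
exact: closed_ge.
Qed.

Lemma open_halfplane s A B : open [set w | 0 < s * orient A B w].
Proof.
apply: (@open_comp _ _ (fun w => s * orient A B w) [set y | 0 < y]).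
  by move=> w _; exact: (cvgM (cvg_cst s) (@orient_continuous A B w)).
exact: open_gt.
Qed.

Lemma hull_closed s A B C D : cvx s A B C D -> closed (hull A B C D).
Proof.
move=> hc.
have -> : hull A B C D = [set w | 0 <= s * orient A B w] `&`
   [set w | 0 <= s * orient B C w] `&` [set w | 0 <= s * orient C D w] `&`
   [set w | 0 <= s * orient D A w].
  apply/seteqP; split=> w; first by move=> /(hullP _ hc)[].
  by move=> [[[h1 h2] h3] h4]; apply/(hullP _ hc).
by do !apply: closedI; exact: closed_halfplane.
Qed.

Lemma hull_interior s A B C D w : cvx s A B C D ->
  [/\ 0 < s * orient A B w, 0 < s * orient B C w,
      0 < s * orient C D w & 0 < s * orient D A w] -> (hull A B C D)° w.
Proof.
move=> hc [h1 h2 h3 h4].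
have : open ([set w | 0 < s * orient A B w] `&`
   [set w | 0 < s * orient B C w] `&` [set w | 0 < s * orient C D w] `&`
   [set w | 0 < s * orient D A w]).
  by do !apply: openI; exact: open_halfplane.
rewrite openE => /(_ w) /(_ (conj (conj (conj h1 h2) h3) h4)).
apply: filterS => z [[[z1 z2] z3] z4].
by apply/(hullP _ hc); split; exact: ltW.
Qed.

(** From an interior point [w], a short step away from [z] stays in [X], hence in the closed
    half-plane. As [z] is strictly inside it, [w] cannot lie on the bounding line. *)
Lemma interior_halfplane X s A B z : 0 < s * orient A B z ->
  X `<=` [set w | 0 <= s * orient A B w] ->
  X° `<=` [set w | 0 < s * orient A B w].
Proof.
move=> hz hX w hw /=.
have hc : {for 0, continuous (fun e : R => w + e *: (w - z))}.
  have F0 : Filter (nbhs (0 : R)) by exact: nbhs_filter.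
  exact: (cvgD (cvg_cst w) (@cvgZr_tmp R _ R _ F0 id 0 (w - z) cvg_id)).
have : \forall e \near (0 : R), X (w + e *: (w - z)).
  by apply: hc; rewrite /= scale0r addr0.
move=> /nbhs_ballP[e /= e0 he].
have e2 : 0 < e / 2 by rewrite divr_gt0.
have : X (w + (e / 2) *: (w - z)).
  by apply: he; rewrite /ball /= sub0r normrN gtr0_norm //; lra.
move/hX => /=.
have -> : orient A B (w + (e / 2) *: (w - z)) =
    orient A B w + e / 2 * (orient A B w - orient A B z).
  by rewrite !orientE !mxE; field.
nra.
Qed.

End Cut.

(** * Glass cuts into three parts *)

Section Dissection.
Variable R : realType.
Implicit Types (A B C D E F u v w z : 'rV[R]_2) (s t r k : R).
Implicit Types X Y Z H K L N : set 'rV[R]_2.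

Local Opaque orient.

(** [chord_cut] orders the two parts by the direction of the chord; this form forgets the order. *)
Definition splits X u v H K := chord_cut X u v H K \/ chord_cut X u v K H.

(** The point is [v] turned about [u] by a quarter turn, and the orientation is the squared length
    of the chord. It serves as the strictly inner point required by [interior_halfplane]. *)
Lemma orient_sq u v : u != v ->
  0 < orient u v (Defs.point (u 0 0 - (v 0 1 - u 0 1)) (u 0 1 + (v 0 0 - u 0 0))).
Proof.
move=> uv; rewrite orientE !mxE /=.
have h : (v 0 0 != u 0 0) || (v 0 1 != u 0 1).
  apply: contraNT uv; rewrite negb_or !negbK => /andP[/eqP h0 /eqP h1].
  by apply/eqP/point_eq.
set x := v 0 0 - u 0 0; set y := v 0 1 - u 0 1.
have -> : x * (u 0 1 + x - u 0 1) - y * (u 0 0 - y - u 0 0) = x ^+ 2 + y ^+ 2 by ring.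
by case/orP: h => h; [apply: ltr_pwDl|apply: ltr_wpDl]; rewrite ?sqr_ge0 //
  exprn_even_gt0 //= subr_eq0.
Qed.

Lemma orientN u v w : orient v u w = - orient u v w.
Proof. by rewrite !orientE; ring. Qed.

(** If [u = v], the open segment is that single point, which would be both interior and on the
    boundary. *)
Lemma chord_cut_neq X u v Y Z : chord_cut X u v Y Z -> u != v.
Proof.
case=> -[_ uX] _ os _ _; apply: contra_notN uX => /eqP uv.
apply: os; apply/open_segmentP; exists (1 / 2); split; first lra.
by rewrite /seg -uv -scalerDl subrK scale1r.
Qed.

Lemma chord_cut_union X u v Y Z : chord_cut X u v Y Z -> Y `|` Z = X.
Proof.
case=> _ _ _ -> ->; apply/seteqP; split=> w; first by case=> -[].
by move=> Xw; have [|/ltW] := lerP 0 (orient u v w); [left|right].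
Qed.

Lemma chord_cut_disjoint X u v Y Z : chord_cut X u v Y Z -> Y° `&` Z° = set0.
Proof.
move=> hc; have uv := chord_cut_neq hc.
case: hc => _ _ _ hY hZ; apply/seteqP; split=> // w [wY wZ].
have h1 : (0 < 1 * orient u v w).
  apply: (@interior_halfplane R Y 1 u v _ _ _ w wY).
    by rewrite mul1r; exact: orient_sq uv.
  by move=> z; rewrite hY /= mul1r => -[].
have h2 : (0 < 1 * orient v u w).
  apply: (@interior_halfplane R Z 1 v u _ _ _ w wZ).
    by rewrite mul1r; apply: orient_sq; rewrite eq_sym.
  by move=> z; rewrite hZ /= mul1r => -[_ h]; rewrite orientN oppr_ge0.
by move: h1 h2; rewrite (orientN u v); lra.
Qed.

Lemma splits_union X u v H K : splits X u v H K -> H `|` K = X.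
Proof. by case=> /chord_cut_union //; rewrite setUC. Qed.

Lemma splits_disjoint X u v H K : splits X u v H K -> H° `&` K° = set0.
Proof. by case=> /chord_cut_disjoint //; rewrite setIC. Qed.

Lemma dissection3 X H K L : H `|` K `|` L = X ->
  H° `&` K° = set0 -> H° `&` L° = set0 -> K° `&` L° = set0 ->
  dissection X [:: H; K; L].
Proof.
move=> hX HK HL KL; split.
  rewrite -hX; apply/seteqP; split=> w.
    by case=> -[|[|[|//]]] _ /= hw; [left; left|left; right|right].
  by case=> [[hw|hw]|hw]; [exists 0%N|exists 1%N|exists 2%N].
apply/trivIsetP => /= i j.
move: i j => [|[|[|//]]] [|[|[|//]]] //= _ _ _; by [|rewrite setIC].
Qed.

(** An inversion principle with explicit equations, as the indices [rcons] and [++] are not in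
    constructor form. *)
Lemma glass_cutE X cs Ps : glass_cut X cs Ps ->
  (cs = [::] /\ Ps = [:: X]) \/
  exists cs' Ps' Y Qs u v Z1 Z2,
    [/\ glass_cut X cs' (Ps' ++ Y :: Qs), chord_cut Y u v Z1 Z2,
        cs = rcons cs' (u, v) & Ps = Ps' ++ [:: Z1, Z2 & Qs]].
Proof.
case=> [|cs' Ps' Y Qs u v Z1 Z2 h1 h2]; first by left.
by right; exists cs', Ps', Y, Qs, u, v, Z1, Z2.
Qed.

Lemma glass_cut0E X Ps : glass_cut X [::] Ps -> Ps = [:: X].
Proof.
by case/glass_cutE => [[]//|[cs' [? [? [? [? [? [? [? [_ _]]]]]]]]]]; case: cs'.
Qed.

Lemma glass_cut_rconsE X cs u v Ps : glass_cut X (rcons cs (u, v)) Ps ->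
  exists Ps' Y Qs Z1 Z2,
    [/\ glass_cut X cs (Ps' ++ Y :: Qs), chord_cut Y u v Z1 Z2 &
        Ps = Ps' ++ [:: Z1, Z2 & Qs]].
Proof.
case/glass_cutE => [[]|]; first by case: cs.
move=> [cs' [Ps' [Y [Qs [u' [v' [Z1 [Z2 [h1 h2 /rcons_inj[ecs eu ev] ->]]]]]]]]].
by exists Ps', Y, Qs, Z1, Z2; subst.
Qed.

Lemma glass_cut1E X u v Ps : glass_cut X [:: (u, v)] Ps ->
  exists Y Z, chord_cut X u v Y Z /\ Ps = [:: Y; Z].
Proof.
move=> /(@glass_cut_rconsE _ [::])[Ps' [Y [Qs [Z1 [Z2 [/glass_cut0E h1 h2 ->]]]]]].
case: Ps' h1 => [[<- ->]|? []//]; by exists Z1, Z2.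
Qed.

(** The lists are replaced by the piece [H] left alone and the piece [K] that is cut again. The
    dissection property is recovered from the two cuts, the interiors of [L] and [N] being contained
    in that of [K]. *)
Lemma glass_cut2P X u1 v1 u2 v2 :
  (exists Ps, self_affinity 3 X Ps /\ glass_cut X [:: (u1, v1); (u2, v2)] Ps) <->
  exists H K L N, [/\ splits X u1 v1 H K, splits K u2 v2 L N &
    [/\ affine_image X H, affine_image X L & affine_image X N]].
Proof.
split=> [[Ps [[_ _ haff]]]|].
  move=> /(@glass_cut_rconsE _ [:: _])[Ps' [Y [Qs [Z1 [Z2 [/glass_cut1E]]]]]].
  move=> [V [W [hVW e]]] hY ePs.
  (* An empty prefix means that the first of the two pieces is cut again, a prefix of length one
     that the second is. *)
  case: Ps' e hY ePs => [[-> ->] hY ePs|P [|? [|? ?]] // [-> -> ->] hY ePs].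
    exists W, V, Z1, Z2; split; [by right|by left|].
    by move: ePs haff => -> haff; split; [apply: (haff 2)|apply: (haff 0)|apply: (haff 1)].
  exists V, W, Z1, Z2; split; [by left|by left|].
  by move: ePs haff => -> haff; split; [apply: (haff 0)|apply: (haff 1)|apply: (haff 2)].
move=> [H [K [L [N [s1 s2 [aH aL aN]]]]]].
have LK : L° `<=` K°.
  by apply: interiorS; rewrite -(splits_union s2) => w; left.
have NK : N° `<=` K°.
  by apply: interiorS; rewrite -(splits_union s2) => w; right.
have HK := splits_disjoint s1.
have LN := splits_disjoint s2.
have HL : H° `&` L° = set0.
  by apply/seteqP; split=> // w [hH /LK hK]; rewrite -HK; split.
have HN : H° `&` N° = set0.
  by apply/seteqP; split=> // w [hH /NK hK]; rewrite -HK; split.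
have NL : N° `&` L° = set0 by rewrite setIC.
have LH : L° `&` H° = set0 by rewrite setIC.
have NH : N° `&` H° = set0 by rewrite setIC.
have eX : H `|` L `|` N = X by rewrite -setUA (splits_union s2) (splits_union s1).
have eX1 : H `|` N `|` L = X by rewrite -setUA (setUC N) setUA.
have eX2 : L `|` N `|` H = X by rewrite setUC setUA.
have eX3 : N `|` L `|` H = X by rewrite (setUC N).
have aff (P Q S : set 'rV[R]_2) : affine_image X P -> affine_image X Q ->
    affine_image X S -> forall n : nat, (n < 3)%N -> affine_image X (nth set0 [:: P; Q; S] n).
  by move=> aP aQ aS [|[|[|//]]].
have g1 V W : chord_cut X u1 v1 V W -> glass_cut X [:: (u1, v1)] [:: V; W].
  by apply: (@glass_cut_rcons _ X [::] [::] X [::]); exact: glass_cut_nil.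
have gl P Q Z1 Z2 : chord_cut X u1 v1 P Q -> chord_cut P u2 v2 Z1 Z2 ->
    glass_cut X [:: (u1, v1); (u2, v2)] [:: Z1; Z2; Q].
  by move=> /g1; apply: (@glass_cut_rcons _ X [:: _] [::] P [:: Q]).
have gr P Q Z1 Z2 : chord_cut X u1 v1 P Q -> chord_cut Q u2 v2 Z1 Z2 ->
    glass_cut X [:: (u1, v1); (u2, v2)] [:: P; Z1; Z2].
  by move=> /g1; apply: (@glass_cut_rcons _ X [:: _] [:: P] Q [::]).
(* The order of the pieces in the list depends on the directions of both chords. *)
case: s1 s2 => h1 [] h2.
- exists [:: H; L; N]; split; last exact: gr h1 h2.
  by split; [|exact: dissection3|exact: aff].
- exists [:: H; N; L]; split; last exact: gr h1 h2.
  by split; [|exact: dissection3|exact: aff].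
- exists [:: L; N; H]; split; last exact: gl h1 h2.
  by split; [|exact: dissection3|exact: aff].
- exists [:: N; L; H]; split; last exact: gl h1 h2.
  by split; [|exact: dissection3|exact: aff].
Qed.

End Dissection.

(** * Chords between opposite sides, and affine maps determined by areas *)

Section Affine.
Variable R : realType.
Implicit Types (A B C D E F u v w z : 'rV[R]_2) (s t r k : R).
Implicit Types X Y Z H K L N : set 'rV[R]_2.
Implicit Types (M : 'M[R]_2) (b : 'rV[R]_2).

Lemma chord_orients A B C D t r q (u := seg t A B) (v := seg r D C)
    (w := seg q u v) :
  [/\ orient A B w = q * ((1 - r) * orient D A B + r * orient A B C),
      orient B C w =
        (1 - q) * ((1 - t) * orient A B C) + q * ((1 - r) * orient B C D),
      orient C D w = (1 - q) * ((1 - t) * orient C D A + t * orient B C D) &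
      orient D A w = (1 - q) * (t * orient D A B) + q * (r * orient C D A)].
Proof. by rewrite /w /u /v !orientE !mxE; split; ring. Qed.

Lemma orient_seg_side A B t : orient A B (seg t A B) = 0.
Proof. by rewrite orientE !mxE; ring. Qed.

Lemma orient_swap A B C : orient A C B = - orient A B C.
Proof. by rewrite !orientE; ring. Qed.

Lemma hull_seg A B C D t r : 0 < t < 1 -> 0 < r < 1 ->
  hull A B C D (seg t A B) /\ hull A B C D (seg r D C).
Proof.
move=> /andP[t0 t1] /andP[r0 r1]; split.
  exists (1 - t), t, 0, 0; split; [by split; lra|by ring|].
  by apply: point_eq; rewrite !mxE; ring.
exists 0, 0, r, (1 - r); split; [by split; lra|by ring|].
by apply: point_eq; rewrite !mxE; ring.
Qed.

Local Opaque orient.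

Lemma hull_side_boundary s A B C D w : cvx s A B C D -> orient A B w = 0 ->
  hull A B C D w -> boundary (hull A B C D) w.
Proof.
move=> hc w0 hw; split; first exact: subset_closure.
move=> hi; have : 0 < s * orient A B w.
  apply: (@interior_halfplane R (hull A B C D) s A B C _ _ w hi).
    by case: hc.
  by move=> z /(hullP _ hc)[].
by rewrite w0 mulr0 ltxx.
Qed.

Lemma chord_interior s A B C D t r : cvx s A B C D -> 0 < t < 1 -> 0 < r < 1 ->
  open_segment (seg t A B) (seg r D C) `<=` (hull A B C D)°.
Proof.
move=> hc /andP[t0 t1] /andP[r0 r1] w /open_segmentP[q [/andP[q0 q1] ->]].
apply: (hull_interior hc); case: hc => ha hb hc hd.
case: (chord_orients A B C D t r q) => -> -> -> ->.
have pos2 (x y p p' : R) : 0 < p -> 0 < p' -> 0 < s * x -> 0 < s * y ->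
    0 < s * (p * x + p' * y).
  by move=> *; rewrite mulrDr !(mulrCA s) addr_gt0 // mulr_gt0.
have t1' : 0 < 1 - t by lra.
have r1' : 0 < 1 - r by lra.
have q1' : 0 < 1 - q by lra.
split.
- by rewrite mulrCA; apply: mulr_gt0 => //; exact: pos2.
- by rewrite (mulrA (1 - q)) (mulrA q); apply: pos2 => //; exact: mulr_gt0.
- by rewrite mulrCA; apply: mulr_gt0 => //; exact: pos2.
- by rewrite (mulrA (1 - q)) (mulrA q); apply: pos2 => //; exact: mulr_gt0.
Qed.

(** The parts are known up to order only, since the sign of [s] decides which of them lies on the
    nonnegative side of the chord. *)
Lemma splitsP s A B C D t r H K (u := seg t A B) (v := seg r D C) :
  cvx s A B C D -> 0 < t < 1 -> 0 < r < 1 ->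
  splits (hull A B C D) u v H K <->
  (H = hull A u v D /\ K = hull u B C v) \/
  (H = hull u B C v /\ K = hull A u v D).
Proof.
move=> hc ht hr; rewrite /u /v (hull_cut hc ht hr) (hull_cut2 hc ht hr).
have bu : boundary (hull A B C D) (seg t A B).
  apply: (hull_side_boundary hc); first exact: orient_seg_side.
  by case: (hull_seg A B C D ht hr).
have bv : boundary (hull A B C D) (seg r D C).
  rewrite hull_rot hull_rot.
  apply: (hull_side_boundary (cvx_rot (cvx_rot hc))).
    by rewrite segC orient_seg_side.
  by rewrite -2!hull_rot; case: (hull_seg A B C D ht hr).
have os := chord_interior hc ht hr.
have cut Y Z : chord_cut (hull A B C D) (seg t A B) (seg r D C) Y Z <->
    Y = hull A B C D `&` [set w | 0 <= orient (seg t A B) (seg r D C) w] /\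
    Z = hull A B C D `&` [set w | orient (seg t A B) (seg r D C) w <= 0].
  by split=> [[]//|[-> ->]]; split.
have [s0|s0|s0] := ltrgtP s 0.
- have -> : [set w | 0 <= s * orient (seg t A B) (seg r D C) w] =
     [set w | orient (seg t A B) (seg r D C) w <= 0].
    by apply/seteqP; split=> w /=; rewrite nmulr_rge0.
  have -> : [set w | s * orient (seg t A B) (seg r D C) w <= 0] =
     [set w | 0 <= orient (seg t A B) (seg r D C) w].
    by apply/seteqP; split=> w /=; rewrite nmulr_rle0.
  split; first by case=> /cut[-> ->]; [right|left].
  by case=> -[-> ->]; [right|left]; apply/cut.
- have -> : [set w | 0 <= s * orient (seg t A B) (seg r D C) w] =
     [set w | 0 <= orient (seg t A B) (seg r D C) w].
    by apply/seteqP; split=> w /=; rewrite pmulr_rge0.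
  have -> : [set w | s * orient (seg t A B) (seg r D C) w <= 0] =
     [set w | orient (seg t A B) (seg r D C) w <= 0].
    by apply/seteqP; split=> w /=; rewrite pmulr_rle0.
  split; first by case=> /cut[-> ->]; [left|right].
  by case=> -[-> ->]; [left|right]; apply/cut.
by case: hc => + _ _ _; rewrite s0 mul0r ltxx.
Qed.

Lemma det2 M : \det M = M 0 0 * M 1 1 - M 0 1 * M 1 0.
Proof.
rewrite (expand_det_row _ 0) !big_ord_recl big_ord0 addr0 /cofactor !det_mx11 !mxE /=.
rewrite !expr0 !expr1 mul1r mulN1r mulrN.
by congr (M _ _ * M _ _ - M _ _ * M _ _); apply/val_inj.
Qed.

Lemma affine_mapE M b u j :
  affine_map M b u 0 j = u 0 0 * M 0 j + u 0 1 * M 1 j + b 0 j.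
Proof.
rewrite /affine_map !mxE !big_ord_recl big_ord0 addr0.
by congr (_ * M _ _ + u _ _ * M _ _ + _); apply/val_inj.
Qed.

Lemma orient_affine M b A B C :
  orient (affine_map M b A) (affine_map M b B) (affine_map M b C) =
  \det M * orient A B C.
Proof. by rewrite !orientE !affine_mapE det2; ring. Qed.

Lemma affine_map_comb M b A B C D (x y z q : R) : x + y + z + q = 1 ->
  affine_map M b (x *: A + y *: B + z *: C + q *: D) =
  x *: affine_map M b A + y *: affine_map M b B + z *: affine_map M b C
  + q *: affine_map M b D.
Proof.
move=> h1; have -> : x = 1 - y - z - q by rewrite -h1; ring.
by apply: point_eq; rewrite !(affine_mapE, mxE) ; ring.
Qed.

Lemma affine_map_hull M b A B C D :
  affine_map M b @` hull A B C D =
  hull (affine_map M b A) (affine_map M b B) (affine_map M b C) (affine_map M b D).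
Proof.
apply/seteqP; split=> [w [z [x [y [p [q [hpos h1 ->]]]]] <-]|w].
  by exists x, y, p, q; split=> //; rewrite affine_map_comb.
case=> [x [y [p [q [hpos h1 ->]]]]].
exists (x *: A + y *: B + p *: C + q *: D); first by exists x, y, p, q.
by rewrite affine_map_comb.
Qed.

(* Twice the signed areas of the triangles formed at A, B, C and D with the two
   neighbouring vertices; up to scaling and relabelling, they determine the
   affine type. *)
Definition areas A B C D := (orient D A B, orient A B C, orient B C D, orient C D A).

Definition scale4 k (x : R * R * R * R) :=
  let: (a, b, c, d) := x in (k * a, k * b, k * c, k * d).

Lemma areas_affine M b A B C D :
  areas (affine_map M b A) (affine_map M b B) (affine_map M b C) (affine_map M b D) =
  scale4 (\det M) (areas A B C D).
Proof. by rewrite /areas !orient_affine. Qed.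

(** The linear part is fixed by the edge vectors at [B]. The fourth vertex is then sent correctly
    because its areal coordinates with respect to [A], [B], [C] are, up to sign, quotients of the
    four areas. *)
Lemma affine_map_exists A B C D A' B' C' D' k : k != 0 -> orient A B C != 0 ->
  areas A' B' C' D' = scale4 k (areas A B C D) ->
  exists M b, M \in unitmx /\
    [/\ affine_map M b A = A', affine_map M b B = B', affine_map M b C = C' &
        affine_map M b D = D'].
Proof.
move=> k0 n0 [eDAB eABC eBCD eCDA].
pose P (U V W : 'rV[R]_2) : 'M[R]_2 :=
  \matrix_(i, j) (if i == 0 then (U - V) 0 j else (W - V) 0 j).
have detP U V W : \det (P U V W) = - orient U V W.
  by rewrite det2 orientE !mxE /=; ring.
have PU : P A B C \in unitmx.
  by rewrite unitmxE detP unitfE oppr_eq0.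
have P'U : P A' B' C' \in unitmx.
  by rewrite unitmxE detP unitfE oppr_eq0 eABC mulf_neq0.
pose M := invmx (P A B C) *m P A' B' C'.
have MP : P A B C *m M = P A' B' C' by rewrite mulmxA mulmxV // mul1mx.
have MU : M \in unitmx by rewrite unitmx_mul unitmx_inv PU.
have rP U V W : row 0 (P U V W) = U - V /\ row 1 (P U V W) = W - V.
  by split; apply/rowP => j; rewrite !mxE.
have [rA rC] := rP A B C; have [rA' rC'] := rP A' B' C'.
have mA : (A - B) *m M = A' - B' by rewrite -rA -rA' -row_mul MP.
have mC : (C - B) *m M = C' - B' by rewrite -rC -rC' -row_mul MP.
exists M, (B' - B *m M); split => //.
have fA : affine_map M (B' - B *m M) A = A'.
  by rewrite /affine_map addrCA -mulmxBl mA addrC subrK.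
have fB : affine_map M (B' - B *m M) B = B'.
  by rewrite /affine_map addrC subrK.
have fC : affine_map M (B' - B *m M) C = C'.
  by rewrite /affine_map addrCA -mulmxBl mC addrC subrK.
split=> //.
have n0' : orient A' B' C' != 0 by rewrite eABC mulf_neq0.
(* The fourth point has coefficient 0, so that the affine combination is one of [A], [B], [C]
   alone. *)
have := affine_map_comb M (B' - B *m M) A B C 0
  (etrans (addr0 _) (barycentric_sum D n0)).
rewrite !scale0r !addr0 fA fB fC -(barycentric D n0) => ->.
rewrite [RHS](barycentric D' n0').
have e1 : orient A' B' D' = k * orient A B D by rewrite (orient_rot D') eDAB (orient_rot D).
have e2 : orient C' A' D' = k * orient C A D.
  by rewrite !(orient_swap _ D) !(orient_swap _ D') eCDA mulrN.
rewrite eBCD eABC e1 e2.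
have kk (x : R) : k * x / (k * orient A B C) = x / orient A B C.
  by rewrite -mulf_div divff // mul1r.
by rewrite !kk.
Qed.

End Affine.

(** * Dihedral relabelling, and recovery of the vertices as extreme points *)

Definition dihedral4 (T : Type) (x : T * T * T * T) : seq (T * T * T * T) :=
  let: (a, b, c, d) := x in
  [:: (a, b, c, d); (b, c, d, a); (c, d, a, b); (d, a, b, c);
      (d, c, b, a); (c, b, a, d); (b, a, d, c); (a, d, c, b)].

Lemma dihedral4_rot (T : eqType) (a b c d : T) :
  dihedral4 (b, c, d, a) =i dihedral4 (a, b, c, d).
Proof.
move=> x; rewrite !inE.
by do 8!case: (x == _); rewrite ?orbT.
Qed.

Lemma dihedral4_id (T : eqType) (a b c d : T) :
  (a, b, c, d) \in dihedral4 (a, b, c, d).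
Proof. exact: mem_head. Qed.

Lemma dihedral4_flip (T : eqType) (a b c d : T) :
  (a, d, c, b) \in dihedral4 (a, b, c, d).
Proof. by rewrite !inE eqxx !orbT. Qed.

Section Extreme.
Variable R : realType.
Implicit Types (A B C D E F u v w z : 'rV[R]_2) (s t r k : R).
Implicit Types X Y Z H K L N : set 'rV[R]_2.

(** Extremality in midpoint form. It depends on the set alone, which allows the vertices to be
    recovered from the hull. *)
Definition extreme X w :=
  X w /\ forall y z, X y -> X z -> y + z = w + w -> y = w.

Lemma orient_meet A B D w : orient A B w = 0 -> orient D A w = 0 ->
  orient D A B != 0 -> w = A.
Proof.
move=> e1 e2 n0.
have h j : w 0 j * orient D A B = A 0 j * orient D A B +
    ((B 0 j - A 0 j) * orient D A w - (A 0 j - D 0 j) * orient A B w).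
  have [->|->] : j = 0 \/ j = 1.
  - by case: j => [[|[|//]] ?]; [left|right]; apply: val_inj.
  - by rewrite !orientE; ring.
  - by rewrite !orientE; ring.
by apply: point_eq; apply: (mulIf n0); rewrite h e1 e2 !mulr0 subrr addr0.
Qed.

Lemma orient_add A B y z w : y + z = w + w ->
  orient A B y + orient A B z = orient A B w + orient A B w.
Proof.
move=> e; have e0 j : y 0 j + z 0 j = w 0 j + w 0 j by have := congr1 (fun v : 'rV[R]_2 => v 0 j) e; rewrite !mxE.
have h0 : y 0 0 = w 0 0 + w 0 0 - z 0 0 by rewrite -(e0 0) addrK.
have h1 : y 0 1 = w 0 1 + w 0 1 - z 0 1 by rewrite -(e0 1) addrK.
by rewrite !orientE h0 h1; ring.
Qed.

Local Opaque orient.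

(** The orientations along [AB] and [DA] have one sign on the hull and vanish at [A]. They therefore
    vanish at any two points of the hull with midpoint [A], and the two lines meet only in [A]. *)
Lemma hull_extreme s A B C D : cvx s A B C D -> extreme (hull A B C D) A.
Proof.
move=> hc; split; first by case: (hull_vertices A B C D).
move=> y z /(hullP _ hc)[y1 _ _ y2] /(hullP _ hc)[z1 _ _ z2] e.
have s0 : s != 0 by case: hc => + _ _ _; apply: contraTneq => ->; rewrite mul0r ltxx.
have e1 := orient_add A B e; rewrite orientABA addr0 in e1.
have e2 := orient_add D A e; rewrite orientABB addr0 in e2.
have o1 : orient A B y = 0.
  apply/eqP; rewrite -(mulrI_eq0 _ (lregP s0)) eq_le y1 andbT.
  by rewrite -oppr_ge0 -mulrN; move/eqP: e1; rewrite addr_eq0 => /eqP ->; rewrite opprK.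
have o2 : orient D A y = 0.
  apply/eqP; rewrite -(mulrI_eq0 _ (lregP s0)) eq_le y2 andbT.
  by rewrite -oppr_ge0 -mulrN; move/eqP: e2; rewrite addr_eq0 => /eqP ->; rewrite opprK.
by apply: (orient_meet o1 o2); case: hc => /gt0_neq0.
Qed.

(* If the coefficient a of A in w is positive, then w moves inside the hull by
   a (A - w) in both directions. *)
Lemma extreme_hull_coef A B C D w (a b c d : R) : extreme (hull A B C D) w ->
  0 < a -> 0 <= b -> 0 <= c -> 0 <= d -> a + b + c + d = 1 ->
  w = a *: A + b *: B + c *: C + d *: D -> w = A.
Proof.
case=> _ hex a0 b0 c0 d0 h1 ew.
have a1 : a <= 1 by lra.
have : w + a *: (A - w) = w.
  apply: (hex _ (w - a *: (A - w))).
  - exists ((1 - a) * a + a), ((1 - a) * b), ((1 - a) * c), ((1 - a) * d); split.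
    + by split; rewrite ?addr_ge0 ?mulr_ge0 //; lra.
    + transitivity ((1 - a) * (a + b + c + d) + a); first by ring.
      by rewrite h1; ring.
    + by rewrite ew; apply: point_eq; rewrite !mxE; ring.
  - exists (a * a), ((1 + a) * b), ((1 + a) * c), ((1 + a) * d); split.
    + by split; rewrite ?mulr_ge0 //; lra.
    + transitivity ((1 + a) * (a + b + c + d) - a); first by ring.
      by rewrite h1; ring.
    + by rewrite ew; apply: point_eq; rewrite !mxE; ring.
  - by rewrite addrACA subrr addr0.
move/(canRL (addKr _)); rewrite addNr => /eqP; rewrite scaler_eq0 subr_eq0.
by case/orP => /eqP e //; move: a0; rewrite e ltxx.
Qed.

Lemma extreme_hull A B C D w : extreme (hull A B C D) w ->
  [\/ w = A, w = B, w = C | w = D].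
Proof.
move=> hex; have [[a [b [c [d [[a0 b0 c0 d0] h1 ew]]]]] _] := hex.
have [a1|a1] := ltrP 0 a.
  by constructor 1; apply: (extreme_hull_coef hex a1 b0 c0 d0).
have [b1|b1] := ltrP 0 b.
  constructor 2; apply: (@extreme_hull_coef B C D A w b c d a) => //.
  - by rewrite -hull_rot.
  - by rewrite -h1; ring.
  - by rewrite ew; apply: point_eq; rewrite !mxE; ring.
have [c1|c1] := ltrP 0 c.
  constructor 3; apply: (@extreme_hull_coef C D A B w c d a b) => //.
  - by rewrite -2!hull_rot.
  - by rewrite -h1; ring.
  - by rewrite ew; apply: point_eq; rewrite !mxE; ring.
constructor 4; apply: (@extreme_hull_coef D A B C w d a b c) => //.
- by rewrite -3!hull_rot.
- by lra.
- by rewrite -h1; ring.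
- by rewrite ew; apply: point_eq; rewrite !mxE; ring.
Qed.

Lemma sign_contra s s' (x y : R) : 0 < s * x -> 0 < s * y -> 0 < s' * x ->
  0 < s' * - y -> False.
Proof. by have [h|h] := ltrP 0 s; have [h'|h'] := ltrP 0 s'; nra. Qed.

(** A repeated vertex makes one of the areas vanish, and an order in which a diagonal of [A B C D]
    becomes a side gives two areas opposite signs. Only two orders beginning with [A] remain. *)
Lemma dihedral_of_common_vertex s s' A B C D B' C' D' :
  cvx s A B C D -> cvx s' A B' C' D' ->
  [\/ B' = A, B' = B, B' = C | B' = D] -> [\/ C' = A, C' = B, C' = C | C' = D] ->
  [\/ D' = A, D' = B, D' = C | D' = D] ->
  (A, B', C', D') = (A, B, C, D) \/ (A, B', C', D') = (A, D, C, B).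
Proof.
move=> [ha hb hc hd] [ha' hb' hc' hd'] hB hC hD.
case: hB => eB; subst B'; first by move: hb'; rewrite orientAAB mulr0 ltxx.
- case: hC => eC; subst C'; try by move: hb'; rewrite ?(orientABA, orientABB) mulr0 ltxx.
    case: hD => eD; subst D'; try by
      [move: hd'; rewrite ?(orientAAB, orientABB) mulr0 ltxx|left|
       move: hc'; rewrite orientABA mulr0 ltxx].
  case: hD => eD; subst D'; try by
      [move: hd'; rewrite ?(orientAAB, orientABB) mulr0 ltxx|
       move: hc'; rewrite orientABA mulr0 ltxx].
  exfalso; apply: (sign_contra (s' := s') hb hc).
    by rewrite orient_rot.
  by rewrite -orient_swap.
- case: hC => eC; subst C'; try by move: hb'; rewrite ?(orientABA, orientABB) mulr0 ltxx.
    case: hD => eD; subst D'; try by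
      [move: hd'; rewrite ?(orientAAB, orientABB) mulr0 ltxx|
       move: hc'; rewrite orientABA mulr0 ltxx].
    exfalso; apply: (sign_contra (s' := s') hd hb).
      by rewrite 2!orient_rot.
    by rewrite -orient_swap.
  case: hD => eD; subst D'; try by
      [move: hd'; rewrite ?(orientAAB, orientABB) mulr0 ltxx|
       move: hc'; rewrite orientABA mulr0 ltxx].
  exfalso; apply: (sign_contra (s' := s') hd hb).
    by rewrite orient_rot.
  by rewrite -orient_swap orient_rot.
- case: hC => eC; subst C'; try by move: hb'; rewrite ?(orientABA, orientABB) mulr0 ltxx.
    case: hD => eD; subst D'; try by
      [move: hd'; rewrite ?(orientAAB, orientABB) mulr0 ltxx|
       move: hc'; rewrite orientABA mulr0 ltxx].
    exfalso; apply: (sign_contra (s' := s') hc hd).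
      by rewrite orient_rot.
    by rewrite -orient_swap.
  case: hD => eD; subst D'; try by
      [move: hd'; rewrite ?(orientAAB, orientABB) mulr0 ltxx|right|
       move: hc'; rewrite orientABA mulr0 ltxx].
Qed.

Lemma extreme_vertex s s' A B C D A' B' C' D' :
  cvx s' A' B' C' D' -> hull A B C D = hull A' B' C' D' ->
  [\/ A' = A, A' = B, A' = C | A' = D].
Proof. by move=> hc e; apply: extreme_hull; rewrite e; exact: hull_extreme hc. Qed.

(** Equal sets have the same extreme points; the four cases rotate the first quadrangle until it
    begins with [A']. *)
Lemma hull_vertices_dihedral s s' A B C D A' B' C' D' :
  cvx s A B C D -> cvx s' A' B' C' D' -> hull A B C D = hull A' B' C' D' ->
  (A', B', C', D') \in dihedral4 (A, B, C, D).
Proof.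
move=> hc hc' e.
have hA := extreme_vertex s hc' e.
have hB : [\/ B' = A, B' = B, B' = C | B' = D].
  by apply: (extreme_vertex s (cvx_rot hc')); rewrite e hull_rot.
have hC : [\/ C' = A, C' = B, C' = C | C' = D].
  by apply: (extreme_vertex s (cvx_rot (cvx_rot hc'))); rewrite e 2!hull_rot.
have hD : [\/ D' = A, D' = B, D' = C | D' = D].
  by apply: (extreme_vertex s (cvx_rot (cvx_rot (cvx_rot hc')))); rewrite e 3!hull_rot.
clear e.
case: hA => eA; subst A'.
- by case: (dihedral_of_common_vertex hc hc' hB hC hD) => ->;
    [exact: dihedral4_id|exact: dihedral4_flip].
- have [] := dihedral_of_common_vertex (cvx_rot hc) hc'.
  + by case: hB => ?; [constructor 4|constructor 1|constructor 2|constructor 3].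
  + by case: hC => ?; [constructor 4|constructor 1|constructor 2|constructor 3].
  + by case: hD => ?; [constructor 4|constructor 1|constructor 2|constructor 3].
  + by move=> ->; rewrite -dihedral4_rot; exact: dihedral4_id.
  + by move=> ->; rewrite -dihedral4_rot; exact: dihedral4_flip.
- have [] := dihedral_of_common_vertex (cvx_rot (cvx_rot hc)) hc'.
  + by case: hB => ?; [constructor 3|constructor 4|constructor 1|constructor 2].
  + by case: hC => ?; [constructor 3|constructor 4|constructor 1|constructor 2].
  + by case: hD => ?; [constructor 3|constructor 4|constructor 1|constructor 2].
  + by move=> ->; rewrite -2!dihedral4_rot; exact: dihedral4_id.
  + by move=> ->; rewrite -2!dihedral4_rot; exact: dihedral4_flip.
- have [] := dihedral_of_common_vertex (cvx_rot (cvx_rot (cvx_rot hc))) hc'.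
  + by case: hB => ?; [constructor 2|constructor 3|constructor 4|constructor 1].
  + by case: hC => ?; [constructor 2|constructor 3|constructor 4|constructor 1].
  + by case: hD => ?; [constructor 2|constructor 3|constructor 4|constructor 1].
  + by move=> ->; rewrite -3!dihedral4_rot; exact: dihedral4_id.
  + by move=> ->; rewrite -3!dihedral4_rot; exact: dihedral4_flip.
Qed.

(** The factor is 1 for the rotations and -1 for the reflections, which reverse every
    orientation. *)
Lemma areas_dihedral A B C D A' B' C' D' :
  (A', B', C', D') \in dihedral4 (A, B, C, D) ->
  exists2 e : R, e != 0 &
    areas A' B' C' D' \in [seq scale4 e x | x <- dihedral4 (areas A B C D)].
Proof.
have n1 : (1 : R) != 0 by exact: oner_neq0.
have n2 : (-1 : R) != 0 by rewrite oppr_eq0.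
rewrite !inE => /or4P[/eqP[-> -> -> ->]|/eqP[-> -> -> ->]|/eqP[-> -> -> ->]|].
- by exists 1 => //; rewrite /areas /= !mul1r !inE eqxx.
- by exists 1 => //; rewrite /areas /= !mul1r !inE eqxx ?orbT.
- by exists 1 => //; rewrite /areas /= !mul1r !inE eqxx ?orbT.
case/or4P => [/eqP[-> -> -> ->]|/eqP[-> -> -> ->]|/eqP[-> -> -> ->]|/orP[]/eqP[-> -> -> ->]].
- by exists 1 => //; rewrite /areas /= !mul1r !inE eqxx ?orbT.
all: exists (-1) => //; rewrite /areas /= !mulN1r.
all: by rewrite (orientC C D A) (orientC B C D) (orientC A B C) (orientC D A B)
  !inE eqxx ?orbT.
Qed.

End Extreme.

(** * Affine equivalence of quadrangles in terms of two ratios of areas *)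

Section Ratios.
Variable R : realType.
Implicit Types (A B C D E F u v w : 'rV[R]_2) (s t r k : R) (x z : R * R * R * R).

(* If the lines AB and CD meet in O, then ratios (areas A B C D) is
   (OA / OB, OD / OC): for X on the line AB, the area of CDX is proportional
   to OX. *)
Definition ratios x : R * R := let: (a, b, c, d) := x in (d / c, a / b).

Definition sim_ratios z : seq (R * R) := [seq ratios x | x <- dihedral4 z].

(** The areas [c] and [d] belong to triangles with the common base [CD], so [c = d] means that [AB]
    and [CD] are parallel; likewise [a = d] for [BC] and [DA]. With [a + c = b + d], the two
    inequalities also give [a != b] and [b != c]. *)
Definition nondeg z :=
  let: (a, b, c, d) := z in
  [&& a != 0, b != 0, c != 0, d != 0, a + c == b + d, c != d & a != d].

Lemma nondeg_dihedral z x : nondeg z -> x \in dihedral4 z -> nondeg x.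
Proof.
case: z => [[[a b] c] d] /and5P[a0 b0 c0 d0 /and3P[/eqP e cd ad]].
have ab : a != b.
  by apply: contra cd => /eqP ab; move/eqP: e; rewrite ab (inj_eq (addrI b)).
have bc : b != c.
  by apply: contra ad => /eqP bc; move/eqP: e; rewrite bc (addrC c) (inj_eq (addIr c)).
have e' : b + d = a + c by [].
rewrite !inE.
by do 7?[case/orP]; move=> /eqP -> /=; rewrite ?a0 ?b0 ?c0 ?d0 /=;
  rewrite ?cd ?ad ?ab ?bc ?(eq_sym b a) ?(eq_sym c b) ?(eq_sym d c) ?(eq_sym d a)
   ?cd ?ad ?ab ?bc ?andbT /=; apply/eqP; rewrite ?(addrC c a) ?(addrC d b) ?e.
Qed.

Lemma ratios_scale k z : k != 0 -> ratios (scale4 k z) = ratios z.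
Proof.
case: z => [[[a b] c] d] k0 /=.
have kk (x y : R) : k * x / (k * y) = x / y by rewrite -mulf_div divff // mul1r.
by rewrite !kk.
Qed.

(** The relation [a + c = b + d] reads [c * (1 - d / c) = b * (1 - a / b)]. Since [d / c] differs
    from 1, the two ratios fix [c / b], and hence all areas up to a factor. *)
Lemma ratios_inj x (a' b' c' d' : R) : nondeg x ->
  b' != 0 -> c' != 0 -> a' + c' = b' + d' -> ratios (a', b', c', d') = ratios x ->
  exists2 k, k != 0 & (a', b', c', d') = scale4 k x.
Proof.
case: x => [[[a b] c] d] /and5P[a0 b0 c0 d0 /and3P[/eqP e cd ad]].
move=> b0' c0' e' [e1 e2].
have ed : d' = d / c * c' by rewrite -e1 divfK.
have ea : a' = a / b * b' by rewrite -e2 divfK.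
have ed0 : d = a + c - b by rewrite e addrAC subrr add0r.
exists (b' / b); first by rewrite mulf_neq0 ?invr_eq0.
have ec : c' = b' / b * c.
  have h : c' * (c - d) = b' / b * c * (c - d).
    have : (c' - d') * c = (b' - a') * c by congr (_ * _); lra.
    rewrite ed ea => h.
    have -> : c' * (c - d) = (c' - d / c * c') * c by field.
    by rewrite h ed0; field.
  by apply: (mulIf _ h); rewrite subr_eq0.
rewrite /= -ec ed ea; congr (_, _, _, _); last first.
  by rewrite ec; field; rewrite b0 c0.
all: by field.
Qed.

Lemma areas_sum A B C D : orient D A B + orient B C D = orient A B C + orient C D A.
Proof. by rewrite !orientE; ring. Qed.

Local Opaque orient.

Lemma sim_hull_affine A B C D A' B' C' D' k : k != 0 -> orient A B C != 0 ->
  areas A' B' C' D' = scale4 k (areas A B C D) ->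
  affine_image (hull A B C D) (hull A' B' C' D').
Proof.
move=> k0 n0 e; have [M [b [MU [eA eB eC eD]]]] := affine_map_exists k0 n0 e.
by exists M, b; split=> //; rewrite affine_map_hull eA eB eC eD.
Qed.

(** An affine map sends a hull to the hull of the images and multiplies the areas by its
    determinant, and equal hulls have the same vertices up to relabelling. The converse is
    [affine_map_exists] applied to the relabelled vertices. *)
Lemma affine_image_hullP s s' A B C D A' B' C' D' :
  cvx s A B C D -> cvx s' A' B' C' D' ->
  affine_image (hull A B C D) (hull A' B' C' D') <->
  exists2 k, k != 0 &
    areas A' B' C' D' \in [seq scale4 k x | x <- dihedral4 (areas A B C D)].
Proof.
move=> hc hc'; split.
  case=> M [b [MU]]; rewrite affine_map_hull => e.
  have dM : \det M != 0 by rewrite -unitfE -unitmxE.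
  (* Dividing [s] by the determinant restores the common sign. *)
  have hcM : cvx (s / \det M) (affine_map M b A) (affine_map M b B)
      (affine_map M b C) (affine_map M b D).
    by case: hc => *; split; rewrite orient_affine mulrA divfK.
  have [e0 en0] := areas_dihedral (hull_vertices_dihedral hcM hc' (esym e)).
  rewrite areas_affine => he; exists (e0 * \det M); first exact: mulf_neq0.
  move: he; rewrite /areas /= !inE !mulrA.
  exact.
have n0 : orient A B C != 0 by case: hc => _ /gt0_neq0.
case=> k k0 /=.
have k0' : - k != 0 by rewrite oppr_eq0.
have r4 A1 B1 C1 D1 : areas A1 B1 C1 D1 = (k * orient D A B, k * orient A B C, k * orient B C D, k * orient C D A)
   -> affine_image (hull A B C D) (hull A1 B1 C1 D1).
  by move=> h; exact: (sim_hull_affine k0 n0).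
have rN A1 B1 C1 D1 : areas A1 B1 C1 D1 = (- k * orient D A B, - k * orient A B C, - k * orient B C D, - k * orient C D A)
   -> affine_image (hull A B C D) (hull A1 B1 C1 D1).
  by move=> h; exact: (sim_hull_affine k0' n0).
(* Reading a quadrangle backwards negates its areas, so the reflected orders need the factor
   [- k]. *)
have oN A1 B1 C1 (x y : R) : orient A1 B1 C1 = x * y -> orient C1 B1 A1 = - x * y.
  by move=> h; rewrite orientC h mulNr.
rewrite !inE => /or4P[/eqP[e1 e2 e3 e4]|/eqP[e1 e2 e3 e4]|/eqP[e1 e2 e3 e4]|].
- by apply: r4; rewrite /areas e1 e2 e3 e4.
- rewrite (hull_rot A') (hull_rot B') (hull_rot C').
  by apply: r4; rewrite /areas e1 e2 e3 e4.
- rewrite (hull_rot A') (hull_rot B').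
  by apply: r4; rewrite /areas e1 e2 e3 e4.
case/or4P => [/eqP[e1 e2 e3 e4]|/eqP[e1 e2 e3 e4]|/eqP[e1 e2 e3 e4]|
  /orP[]/eqP[e1 e2 e3 e4]].
- by rewrite (hull_rot A'); apply: r4; rewrite /areas e1 e2 e3 e4.
all: have [f1 f2 f3 f4] := And4 (oN _ _ _ _ _ e1) (oN _ _ _ _ _ e2)
  (oN _ _ _ _ _ e3) (oN _ _ _ _ _ e4).
all: rewrite (hull_rev A').
- by apply: rN; rewrite /areas f1 f2 f3 f4.
- by rewrite (hull_rot D'); apply: rN; rewrite /areas f1 f2 f3 f4.
- by rewrite (hull_rot D') (hull_rot C'); apply: rN; rewrite /areas f1 f2 f3 f4.
- by rewrite (hull_rot D') (hull_rot C') (hull_rot B'); apply: rN; rewrite /areas f1 f2 f3 f4.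
Qed.

Lemma affine_image_ratiosP s s' A B C D A' B' C' D' :
  cvx s A B C D -> cvx s' A' B' C' D' -> nondeg (areas A B C D) ->
  affine_image (hull A B C D) (hull A' B' C' D') ->
  ratios (areas A' B' C' D') \in sim_ratios (areas A B C D).
Proof.
move=> hc hc' nd /(affine_image_hullP hc hc')[k k0 /mapP[x hx ->]].
by rewrite ratios_scale // map_f.
Qed.

Lemma ratios_affine_image s s' A B C D A' B' C' D' :
  cvx s A B C D -> cvx s' A' B' C' D' -> nondeg (areas A B C D) ->
  ratios (areas A' B' C' D') \in sim_ratios (areas A B C D) ->
  affine_image (hull A B C D) (hull A' B' C' D').
Proof.
move=> hc hc' nd /mapP[x hx e]; apply/(affine_image_hullP hc hc').
case: (hc') => _ /gt0_neq0 b0 /gt0_neq0 c0 _.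
have [k k0 ek] := ratios_inj (nondeg_dihedral nd hx) b0 c0 (areas_sum A' B' C' D') e.
by exists k => //; rewrite /areas ek map_f.
Qed.

Lemma nondeg_sim_ratios z l m : nondeg z -> (l, m) \in sim_ratios z -> l != 1.
Proof.
move=> nd /mapP[[[[a b] c] d] hx [-> _]]; move: (nondeg_dihedral nd hx).
case/and5P => _ _ c0 _ /and3P[_ cd _].
by apply: contra cd => /eqP e; rewrite -(divfK c0 d) e mul1r.
Qed.

End Ratios.

(** * The numerical conditions for both types, their symmetries and their solution *)

Section Numeric.
Variable R : realType.
Implicit Types (z : R * R * R * R).

Definition same_side (l : seq (R * R)) :=
  all (fun q => (0 < q.1 < 1) && (0 < q.2 < 1)) l ||
  all (fun q => (1 < q.1) && (1 < q.2)) l.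

(* The three pairs are the ratios of the pieces, which multiply to those of the
   whole quadrangle; they are all below 1 or all above 1 since the cuts run
   monotonically from one end of the two opposite sides to the other. *)
Definition ratios_A z := exists l1 m1 l2 m2 l3 m3,
  [/\ [/\ (l1, m1) \in sim_ratios z, (l2, m2) \in sim_ratios z &
          (l3, m3) \in sim_ratios z],
      ratios z = (l1 * (l2 * l3), m1 * (m2 * m3)) &
      same_side [:: (l1, m1); (l2, m2); (l3, m3)]].

(* A quadrangle with areas (a, b, c, d) and ratios (L, M) has
   (a / d, b / c) = cross_ratios L M. *)
Definition cross_ratios (L M : R) := ((M * (1 - L)) / (L * (1 - M)), (1 - L) / (1 - M)).

(* (l, m) belongs to the piece cut off first and (L, M) to the remaining one,
   which is then cut in the transversal direction. *)
Definition ratios_B z := exists l m L M p1 q1 p2 q2,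
  [/\ [/\ (l, m) \in sim_ratios z, (p1, q1) \in sim_ratios z &
          (p2, q2) \in sim_ratios z],
      ratios z = (l * L, m * M),
      L != M, cross_ratios L M = (p1 * p2, q1 * q2) &
      same_side [:: (l, m); (L, M)] /\ same_side [:: (p1, q1); (p2, q2)]].

Lemma sim_ratios_scale k z : k != 0 -> sim_ratios (scale4 k z) = sim_ratios z.
Proof.
by case: z => [[[a b] c] d] k0; rewrite /sim_ratios /=;
  do 8!(congr cons; first exact: (@ratios_scale _ k (_, _, _, _))).
Qed.

Lemma ratios_A_scale k z : k != 0 -> ratios_A (scale4 k z) <-> ratios_A z.
Proof. by move=> k0; rewrite /ratios_A sim_ratios_scale // ratios_scale. Qed.

Lemma ratios_B_scale k z : k != 0 -> ratios_B (scale4 k z) <-> ratios_B z.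
Proof. by move=> k0; rewrite /ratios_B sim_ratios_scale // ratios_scale. Qed.

Lemma dihedral4_rev (T : eqType) (a b c d : T) :
  dihedral4 (d, c, b, a) =i dihedral4 (a, b, c, d).
Proof. by move=> x; rewrite !inE; do 8!case: (x == _); rewrite ?orbT. Qed.

Lemma dihedral4_swap (T : eqType) (a b c d : T) :
  dihedral4 (b, a, d, c) =i dihedral4 (a, b, c, d).
Proof. by move=> x; rewrite dihedral4_rev 2!dihedral4_rot. Qed.

Lemma sim_ratios_rev (a b c d : R) :
  sim_ratios (d, c, b, a) =i sim_ratios (a, b, c, d).
Proof. exact: (eq_mem_map (@ratios R) (dihedral4_rev a b c d)). Qed.

Lemma sim_ratios_swap (a b c d : R) :
  sim_ratios (b, a, d, c) =i sim_ratios (a, b, c, d).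
Proof. exact: (eq_mem_map (@ratios R) (dihedral4_swap a b c d)). Qed.

(** Exchanging [A] with [B] and [C] with [D] exchanges numerators and denominators. *)
Lemma sim_ratiosV (a b c d l m : R) : (l, m) \in sim_ratios (a, b, c, d) ->
  (l^-1, m^-1) \in sim_ratios (b, a, d, c).
Proof.
case/mapP => [[[[a' b'] c'] d'] h [-> ->]]; apply/mapP; exists (b', a', d', c').
  rewrite dihedral4_swap; move: h; rewrite !inE.
  by do 7?[case/orP]; move=> /eqP[-> -> -> ->]; rewrite eqxx ?orbT.
by rewrite /= !invf_div.
Qed.

Lemma sim_ratiosC (a b c d l m : R) : (l, m) \in sim_ratios (a, b, c, d) ->
  (m, l) \in sim_ratios (d, c, b, a).
Proof.
case/mapP => [[[[a' b'] c'] d'] h [-> ->]]; apply/mapP; exists (d', c', b', a') => //.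
rewrite dihedral4_rev; move: h; rewrite !inE.
by do 7?[case/orP]; move=> /eqP[-> -> -> ->]; rewrite eqxx ?orbT.
Qed.

Lemma same_sideV (l : seq (R * R)) :
  same_side l -> same_side [seq (q.1^-1, q.2^-1) | q <- l].
Proof.
rewrite /same_side !all_map => /orP[h|h]; apply/orP; [right|left];
  apply: sub_all h => q /=.
  by case/andP => /andP[p0 p1] /andP[q0 q1]; rewrite !invf_gt1 // p1.
case/andP => p1 q1; have p0 := lt_trans ltr01 p1; have q0 := lt_trans ltr01 q1.
by rewrite !invr_gt0 !invf_lt1 // p0 p1 q0.
Qed.

Lemma same_sideC (l : seq (R * R)) : same_side [seq (q.2, q.1) | q <- l] = same_side l.
Proof.
by rewrite /same_side !all_map; congr (_ || _); apply: eq_all => q /=; rewrite andbC.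
Qed.

Lemma ratios_A_swap (a b c d : R) : ratios_A (a, b, c, d) -> ratios_A (b, a, d, c).
Proof.
case=> l1 [m1 [l2 [m2 [l3 [m3 [[h1 h2 h3] [e1 e2] hs]]]]]].
exists l1^-1, m1^-1, l2^-1, m2^-1, l3^-1, m3^-1; split.
- by split; exact: sim_ratiosV.
- by rewrite /= -!invfM -e1 -e2 !invf_div.
- exact: (same_sideV hs).
Qed.

Lemma ratios_A_rev (a b c d : R) : ratios_A (a, b, c, d) -> ratios_A (d, c, b, a).
Proof.
case=> l1 [m1 [l2 [m2 [l3 [m3 [[h1 h2 h3] [e1 e2] hs]]]]]].
exists m1, l1, m2, l2, m3, l3; split.
- by split; exact: sim_ratiosC.
- by rewrite /= e1 e2.
- by rewrite -same_sideC.
Qed.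

Lemma cross_ratiosV (L M : R) : L != 0 -> M != 0 -> L != 1 -> M != 1 ->
  cross_ratios L^-1 M^-1 = ((cross_ratios L M).2, (cross_ratios L M).1).
Proof.
move=> L0 M0 L1 M1; rewrite /cross_ratios /=; congr (_, _); field.
  by rewrite L0 M0 !subr_eq0 (eq_sym 1) M1.
by rewrite L0 M0 !subr_eq0 (eq_sym 1) M1.
Qed.

Lemma cross_ratiosC (L M : R) :
  cross_ratios M L = ((cross_ratios L M).1^-1, (cross_ratios L M).2^-1).
Proof. by rewrite /cross_ratios /= !invf_div. Qed.

Lemma same_side_neq (l m L M : R) : same_side [:: (l, m); (L, M)] ->
  [/\ L != 0, M != 0, L != 1 & M != 1].
Proof.
rewrite /same_side /= !andbT.
by move=> /orP[/andP[_ /andP[/andP[? ?] /andP[? ?]]]|/andP[_ /andP[? ?]]]; split; lra.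
Qed.

Lemma ratios_B_swap (a b c d : R) : ratios_B (a, b, c, d) -> ratios_B (b, a, d, c).
Proof.
case=> l [m [L [M [p1 [q1 [p2 [q2 [[h1 h2 h3] [e1 e2] LM ecr [s1 s2]]]]]]]]].
have [L0 M0 L1 M1] := same_side_neq s1.
have sw p q : (p, q) \in sim_ratios (a, b, c, d) -> (q, p) \in sim_ratios (b, a, d, c).
  by move=> /sim_ratiosC; rewrite sim_ratios_rev sim_ratios_swap.
(* The mirror image inverts the ratios along [AB] and [CD] and transposes those of the transversal
   cut. *)
exists l^-1, m^-1, L^-1, M^-1, q1, p1, q2, p2; split.
- by split; [exact: sim_ratiosV|exact: sw|exact: sw].
- by rewrite /= -!invfM -e1 -e2 !invf_div.
- by rewrite (inj_eq invr_inj).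
- by rewrite cross_ratiosV // ecr.
- by split; [exact: (same_sideV s1)|rewrite -same_sideC].
Qed.

Lemma ratios_B_rev (a b c d : R) : ratios_B (a, b, c, d) -> ratios_B (d, c, b, a).
Proof.
case=> l [m [L [M [p1 [q1 [p2 [q2 [[h1 h2 h3] [e1 e2] LM ecr [s1 s2]]]]]]]]].
have sw p q : (p, q) \in sim_ratios (a, b, c, d) ->
    (p^-1, q^-1) \in sim_ratios (d, c, b, a).
  by move=> /sim_ratiosV; rewrite sim_ratios_rev sim_ratios_swap.
(* Reversal acts the other way round: it transposes the first two pairs and inverts the transversal
   ones. *)
exists m, l, M, L, p1^-1, q1^-1, p2^-1, q2^-1; split.
- by split; [exact: sim_ratiosC|exact: sw|exact: sw].
- by rewrite /= e1 e2.
- by rewrite eq_sym.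
- by rewrite cross_ratiosC ecr -!invfM.
- by split; [rewrite -same_sideC|exact: (same_sideV s2)].
Qed.

Lemma same_side_lt1 (p : R * R) (l : seq (R * R)) :
  same_side (p :: l) -> p.1 < 1 -> all (fun q => (0 < q.1 < 1) && (0 < q.2 < 1)) (p :: l).
Proof. by case/orP => // /andP[/andP[h _] _] h'; move: (lt_trans h h'); rewrite ltxx. Qed.

(* The quadrangle Q[x,y] has areas (x, 1, y, s), hence ratios (u, x) along AB
   and DC, and ratios (v^-1, y^-1) along BC and AD. *)
Section Normal.
Variables x y : R.
Hypotheses (x1 : x < 1) (y1 : y < 1) (xy1 : 1 < x + y).
Let s := x + y - 1.
Let u := s / y.
Let v := s / x.

Let x0 : 0 < x. Proof. move: x1 y1 xy1; lra. Qed.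
Let y0 : 0 < y. Proof. move: x1 y1 xy1; lra. Qed.
Let s0 : 0 < s. Proof. move: xy1; rewrite /s; lra. Qed.
Let uy : u * y = s. Proof. by rewrite divfK // gt_eqF. Qed.
Let vx : v * x = s. Proof. by rewrite divfK // gt_eqF. Qed.
(** This says [0 < (1 - x) * (1 - y)]; it is the source of [u < x] and [v < y]. *)
Let sxy : s < x * y. Proof. move: x1 y1; rewrite /s; nra. Qed.
Let u0 : 0 < u. Proof. exact: divr_gt0. Qed.
Let v0 : 0 < v. Proof. exact: divr_gt0. Qed.
Let ux : u < x. Proof. by rewrite -(ltr_pM2r y0) uy. Qed.
Let vy : v < y. Proof. by rewrite -(ltr_pM2r x0) vx mulrC. Qed.

Lemma sim_ratios_normal l m : (l, m) \in sim_ratios (x, 1, y, s) =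
  ((l, m) \in [:: (u, x); (x, u); (v, y); (y, v);
     (u^-1, x^-1); (x^-1, u^-1); (v^-1, y^-1); (y^-1, v^-1)]).
Proof.
rewrite /sim_ratios /= !divr1 !div1r -/u -/v -!(invf_div s) -/u -/v !inE.
by do 8!case: (_ == _); rewrite ?orbT.
Qed.

Lemma sim_ratios_normal_lt1 l m : (l, m) \in sim_ratios (x, 1, y, s) -> l < 1 ->
  (l, m) \in [:: (u, x); (x, u); (v, y); (y, v)].
Proof.
have inv (q : R) : 0 < q -> q < 1 -> 1 < q^-1 by move=> q0 q1; rewrite invf_gt1.
have ui := inv u u0 (lt_trans ux x1); have xi := inv x x0 x1.
have vi := inv v v0 (lt_trans vy y1); have yi := inv y y0 y1.
rewrite sim_ratios_normal !inE => h h1; move: h.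
do 7?[case/orP]; move=> /eqP[e1 e2]; rewrite ?e1 ?e2 ?eqxx ?orbT //;
  by move: h1; rewrite e1; lra.
Qed.

Lemma sim_ratios_normal_gt1 l m : (l, m) \in sim_ratios (x, 1, y, s) -> 1 < l ->
  (l, m) \in [:: (u^-1, x^-1); (x^-1, u^-1); (v^-1, y^-1); (y^-1, v^-1)].
Proof.
have u1 := lt_trans ux x1; have v1 := lt_trans vy y1.
rewrite sim_ratios_normal !inE => h h1; move: h.
do 7?[case/orP]; move=> /eqP[e1 e2]; rewrite ?e1 ?e2 ?eqxx ?orbT //;
  by move: h1 u1 v1 x1 y1; rewrite e1; lra.
Qed.

(* A piece spanning the full length of Q would have ratios (u, x) or (x, u),
   but u and x are the ratios of Q itself and u < x. *)
Lemma proper_piece l m q w : (l, m) \in sim_ratios (x, 1, y, s) -> l < 1 ->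
  0 < q < 1 -> 0 < w < 1 -> l * q = u -> m * w = x ->
  (l, m) = (v, y) \/ (l, m) = (y, v).
Proof.
move=> h l1 /andP[q0 q1] /andP[w0 w1] eq ew.
move: (sim_ratios_normal_lt1 h l1); rewrite !inE.
do 3?[case/orP]; move=> /eqP[e1 e2]; [exfalso|exfalso|left|right]; rewrite ?e1 ?e2 //.
  by move: u0 eq; rewrite e1; nra.
by move: u0 ux ew; rewrite e2; nra.
Qed.

Lemma ratios_A_normal : ratios_A (x, 1, y, s) <-> curve_A (x, y).
Proof.
have vx' := vx; have vy' := vy; have uy' := uy; have ux' := ux; have s0' := s0.
have x0' := x0; have y0' := y0; have u0' := u0; have v0' := v0; have sxy' := sxy.
have x1' := x1; have y1' := y1.
split.
  case=> l1 [m1 [l2 [m2 [l3 [m3 [[h1 h2 h3] [e1 e2] hs]]]]]].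
  rewrite -/u divr1 in e1 e2.
  (* The three first ratios multiply to [u < 1], which rules out the alternative above 1. *)
  have lt1 : l1 < 1.
    case/orP: hs => /=; first by case/andP => /andP[/andP[]].
    case/and4P => /andP[? ?] /andP[? ?] /andP[? ?] _.
    have : 1 < l1 * (l2 * l3) by rewrite !mulr_egt1.
    by rewrite -e1; lra.
  have := same_side_lt1 hs lt1.
  rewrite /= => /and4P[/andP[/andP[p1 p1'] /andP[q1 q1']]
    /andP[/andP[p2 p2'] /andP[q2 q2']] /andP[/andP[p3 p3'] /andP[q3 q3']] _].
  have in01 (a b : R) : 0 < a -> a < 1 -> 0 < b -> b < 1 -> 0 < a * b < 1.
    by move=> *; rewrite mulr_gt0 // mulr_ilt1 // ltW.
  have g1 : (l1, m1) = (v, y) \/ (l1, m1) = (y, v).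
    by apply: (proper_piece h1 p1' (q := l2 * l3) (w := m2 * m3)) => //; exact: in01.
  have g2 : (l2, m2) = (v, y) \/ (l2, m2) = (y, v).
    apply: (proper_piece h2 p2' (q := l1 * l3) (w := m1 * m3)); try exact: in01.
      by rewrite e1; ring.
    by rewrite e2; ring.
  have g3 : (l3, m3) = (v, y) \/ (l3, m3) = (y, v).
    apply: (proper_piece h3 p3' (q := l1 * l2) (w := m1 * m2)); try exact: in01.
      by rewrite e1; ring.
    by rewrite e2; ring.
  (* The second ratios multiply to [x]. Two pairs [(v, y)] and one [(y, v)] give the claim; the
     other choices contradict either [u < x] or [u * y = v * x] with [v < y]. *)
  have key : v * y ^+ 2 = x.
    have bad1 : u = v ^+ 3 -> x = y ^+ 3 -> False.
      move=> a1 a2; have : v * y * ((y - v) * (y + v)) = 0.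
        by transitivity (v * x - u * y); [rewrite a1 a2; ring|rewrite uy' vx' subrr].
      have : 0 < v * y * ((y - v) * (y + v)).
        by rewrite mulr_gt0 // mulr_gt0 // ?subr_gt0 // addr_gt0.
      by move=> + e0; rewrite e0 ltxx.
    have bad2 : u = y ^+ 3 -> x = v ^+ 3 -> False.
      move=> a1 a2; have : v ^+ 3 < y ^+ 3 by rewrite ltrXn2r // ltW.
      by rewrite -a1 -a2; lra.
    have bad3 : u = v * y ^+ 2 -> x = v ^+ 2 * y -> False.
      move=> a1 a2; have : v * y * v < v * y * y by rewrite ltr_pM2l // mulr_gt0.
      by move: ux'; rewrite a1 a2; lra.
    case: g1 => -[a1 b1]; case: g2 => -[a2 b2]; case: g3 => -[a3 b3];
      rewrite a1 a2 a3 in e1; rewrite b1 b2 b3 in e2.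
    - by case: bad1; rewrite ?e1 ?e2; ring.
    - by rewrite e2; ring.
    - by rewrite e2; ring.
    - by case: bad3; rewrite ?e1 ?e2; ring.
    - by rewrite e2; ring.
    - by case: bad3; rewrite ?e1 ?e2; ring.
    - by case: bad3; rewrite ?e1 ?e2; ring.
    - by case: bad2; rewrite ?e1 ?e2; ring.
  have e : x ^+ 2 = s * y ^+ 2.
    by rewrite -vx' mulrAC key.
  split=> //; last by rewrite -[RHS](subrr (x ^+ 2)) {2}e /s; ring.
  (* [x < y] holds because [x ^+ 2 = s * y ^+ 2] with [s < 1]. *)
  rewrite -(ltr_pXn2r (isT : (0 < 2)%N)) ?nnegrE ?ltW // e.
  by rewrite gtr_pMl ?exprn_gt0 // /s; lra.
case=> _ _ xy e.
have {}e : x ^+ 2 = s * y ^+ 2.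
  by apply/eqP; rewrite -subr_eq0 -oppr_eq0 -e /s; apply/eqP; ring.
have xn : x != 0 by rewrite gt_eqF.
have yn : y != 0 by rewrite gt_eqF.
have in_vy : (v, y) \in sim_ratios (x, 1, y, s).
  by rewrite sim_ratios_normal !inE eqxx ?orbT.
have in_yv : (y, v) \in sim_ratios (x, 1, y, s).
  by rewrite sim_ratios_normal !inE eqxx ?orbT.
exists v, y, v, y, y, v; split=> //; last first.
  by apply/orP; left; rewrite /= v0 y0 y1 (lt_trans vy y1).
rewrite /= divr1 -/u; congr (_, _).
  apply: (mulIf yn); rewrite uy'.
  have -> : v * (v * y) * y = v ^+ 2 * y ^+ 2 by ring.
  rewrite /v expr_div_n e; field.
  by rewrite yn gt_eqF.
rewrite /v.
have -> : y * (y * (s / x)) = s * y ^+ 2 / x by field.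
by rewrite -e; field.
Qed.

(* [fB1 = 0] and [fB2 = 0] say that [(1 - L) / (1 - M)] equals [1 / x^2] and
   [1 / (x y)], respectively, for [L = s / y^2] and [M = x^2 / s]. *)
Let fB1 := y ^+ 2 * (s - x ^+ 2) - x ^+ 2 * s * (y ^+ 2 - s).

Let fB2 := y * (s - x ^+ 2) - x * s * (y ^+ 2 - s).

(** The cofactor [(1 - x) * (x + y)] is positive, so [fB1] vanishes only together with the
    polynomial of the first family. *)
Let fB1E : fB1 =
  (1 - x) * (x + y) * ((x + 1) * y ^+ 2 - (x + 1) * y + x * (1 - x)).
Proof. by rewrite /fB1 /s; ring. Qed.

Let fB2E : fB2 = x ^+ 3 + (- y ^+ 2 + y - 2) * x ^+ 2
  + (- y ^+ 3 + 2 * y ^+ 2 - y + 1) * x + y ^+ 2 - y.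
Proof. by rewrite /fB2 /s; ring. Qed.

Lemma ratios_B_curve : ratios_B (x, 1, y, s) ->
  curve_B1 (x, y) \/ curve_B2 (x, y).
Proof.
have vx' := vx; have vy' := vy; have uy' := uy; have ux' := ux; have s0' := s0.
have x0' := x0; have y0' := y0; have u0' := u0; have v0' := v0; have sxy' := sxy.
have x1' := x1; have y1' := y1; have xy1' := xy1.
have xn : x != 0 by rewrite gt_eqF.
have yn : y != 0 by rewrite gt_eqF.
have sn : s != 0 by rewrite gt_eqF.
have un : u != 0 by rewrite gt_eqF.
have vn : v != 0 by rewrite gt_eqF.
case=> l [m [L [M [p1 [q1 [p2 [q2 [[h1 h2 h3] [e1 e2] LM [cP cQ] [s1 s2]]]]]]]]].
rewrite -/u divr1 in e1 e2.
have lt1 : l < 1.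
  case/orP: s1 => /=; first by case/andP => /andP[/andP[]].
  case/and3P => /andP[? ?] /andP[? ?] _.
  have : 1 < l * L by rewrite mulr_egt1.
  by rewrite -e1; lra.
have := same_side_lt1 s1 lt1.
rewrite /= => /and3P[/andP[/andP[l0 l1] /andP[m0 m1]]
    /andP[/andP[L0 L1] /andP[M0 M1]] _].
(* For [(v, y)] the relation [u * y = v * x] would force [L = M]. *)
have [[el em]|[el em]] : (l, m) = (v, y) \/ (l, m) = (y, v).
    by apply: (proper_piece h1 l1 (q := L) (w := M)); rewrite ?L0 ?M0.
  case/eqP: LM; apply: (mulfI (mulf_neq0 vn yn)).
  transitivity (u * y); first by rewrite e1 el; ring.
  by rewrite uy' -vx' e2 em; ring.
(* The first piece has the pair [(y, v)], so [L = u / y] and [M = x / v]. *)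
have Ly : L * y ^+ 2 = s by rewrite -uy' e1 el; ring.
have Ms : M * s = x ^+ 2 by rewrite -vx' expr2 {2}e2 em; ring.
have sy2 : s < y ^+ 2 by rewrite -Ly gtr_pMl // exprn_gt0.
have x2s : x ^+ 2 < s by rewrite -Ms gtr_pMl.
(* Equivalent to [s ^+ 2 < x ^+ 2 * y ^+ 2]. *)
have LltM : L < M.
  rewrite -(ltr_pM2r (mulr_gt0 (exprn_gt0 2 y0') s0')).
  have -> : L * (y ^+ 2 * s) = L * y ^+ 2 * s by ring.
  have -> : M * (y ^+ 2 * s) = M * s * y ^+ 2 by ring.
  by rewrite Ly Ms -exprMn -expr2 ltrXn2r // ltW.
have xy : x < y.
  rewrite -(ltr_pXn2r (isT : (0 < 2)%N)) ?nnegrE ?ltW //.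
  exact: lt_trans x2s sy2.
have L1n : 1 - L != 0 by rewrite gt_eqF // subr_gt0.
have M1n : 1 - M != 0 by rewrite gt_eqF // subr_gt0.
have Ln : L != 0 by rewrite gt_eqF.
have cQ' : 1 - L = q1 * q2 * (1 - M) by rewrite -cQ divfK.
have cPQ : p1 * p2 * L = q1 * q2 * M.
  by rewrite -cP -cQ; field; rewrite Ln M1n.
(* As [L < M], the second cross ratio exceeds 1, which puts the transversal pairs above 1. *)
have Q1 : 1 < q1 * q2.
  by rewrite -(ltr_pM2r (_ : 0 < 1 - M)) ?subr_gt0 // -cQ' mul1r ltrD2l ltrN2.
have : all (fun q => (1 < q.1) && (1 < q.2)) [:: (p1, q1); (p2, q2)].
  case/orP: s2 => // /= /and3P[/andP[_ /andP[? ?]] /andP[_ /andP[? ?]] _].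
  have lt : q1 * q2 < 1 by rewrite mulr_ilt1 // ltW.
  by move: (lt_trans lt Q1); rewrite ltxx.
rewrite /= => /and3P[/andP[p11 q11] /andP[p21 q21] _].
(* [p1 * p2 * L = q1 * q2 * M] with [L < M] requires [p1 * p2] to be the larger product. *)
have bad : p1 * p2 <= q1 * q2 -> False.
  move=> PQ; have : p1 * p2 * L < q1 * q2 * M.
    apply: (le_lt_trans (y := q1 * q2 * L)); first by rewrite ler_pM2r.
    by rewrite ltr_pM2l // (lt_trans _ Q1).
  by rewrite cPQ ltxx.
have ixu : x^-1 < u^-1 by rewrite ltf_pV2.
have iyv : y^-1 < v^-1 by rewrite ltf_pV2.
have pos q : 0 < q -> 0 < q^-1 :> R by rewrite invr_gt0.
have xi := pos x x0'; have yi := pos y y0'; have ui := pos u u0'; have vi := pos v v0'.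
have uyvx : u^-1 * y^-1 = x^-1 * v^-1 by rewrite -!invfM uy' mulrC vx'.
have final q : q != 0 -> q1 * q2 = q^-1 -> q * (1 - L) = 1 - M.
  by move=> q0 eq; rewrite cQ' eq mulrA mulfV // mul1r.
have eLM q : q * (1 - L) = 1 - M -> q * s * (y ^+ 2 - s) = y ^+ 2 * (s - x ^+ 2).
  move=> eq; transitivity (s * y ^+ 2 * (q * (1 - L))).
    by rewrite -{2}Ly; ring.
  by rewrite eq -Ms; ring.
have caseB1 : q1 * q2 = (x * x)^-1 -> curve_B1 (x, y) \/ curve_B2 (x, y).
  move=> /(final _ (mulf_neq0 xn xn)) /eLM h; left; split=> //.
  have : fB1 = 0 by rewrite /fB1 -h; ring.
  rewrite fB1E => /eqP; rewrite mulf_eq0 => /orP[|/eqP//].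
  by rewrite gt_eqF // mulr_gt0 ?subr_gt0 // addr_gt0.
have caseB2 : q1 * q2 = (x * y)^-1 -> curve_B1 (x, y) \/ curve_B2 (x, y).
  move=> /(final _ (mulf_neq0 xn yn)) /eLM h; right; split=> //.
  rewrite -fB2E; apply: (mulfI yn); rewrite mulr0.
  transitivity (y ^+ 2 * (s - x ^+ 2) - x * y * s * (y ^+ 2 - s)).
    by rewrite /fB2; ring.
  by rewrite h subrr.
(* The difference of the two sides is [y ^+ 2 * (1 - y) ^+ 2 * (x + y)], which is positive. *)
have caseB3 : q1 * q2 = (y * y)^-1 -> False.
  move=> /(final _ (mulf_neq0 yn yn)) /eLM h.
  have : y ^+ 2 * ((1 - y) * ((1 - y) * (x + y))) = 0.
    transitivity (y * y * s * (y ^+ 2 - s) - y ^+ 2 * (s - x ^+ 2)).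
      by rewrite /s; ring.
    by rewrite h subrr.
  apply/eqP; rewrite gt_eqF // mulr_gt0 ?exprn_gt0 // mulr_gt0 ?subr_gt0 //.
  by rewrite mulr_gt0 ?subr_gt0 // addr_gt0.
(* Of the sixteen combinations, [bad] leaves only those in which both pairs are among [(u^-1, x^-1)]
   and [(v^-1, y^-1)]. *)
move: (sim_ratios_normal_gt1 h2 p11) (sim_ratios_normal_gt1 h3 p21).
rewrite !inE => g2 g3; clear cP cQ cQ' cPQ final h2 h3 s2 Q1 p11 q11 p21 q21.
move: g2; do 3?[case/orP]; move=> /eqP[a1 b1]; subst p1 q1;
  move: g3; do 3?[case/orP]; move=> /eqP[a2 b2]; subst p2 q2.
- by apply: caseB1; rewrite -invfM.
- by case: bad; rewrite mulrC.
- by apply: caseB2; rewrite -invfM.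
- by case: bad; rewrite uyvx.
- by case: bad; rewrite mulrC.
- by case: bad; rewrite ler_pM // ltW.
- by case: bad; rewrite uyvx.
- by case: bad; rewrite ler_pM // ltW.
- by apply: caseB2; rewrite mulrC -invfM.
- by case: bad; rewrite (mulrC v^-1) -uyvx mulrC.
- by case: caseB3; rewrite -invfM.
- by case: bad; rewrite mulrC.
- by case: bad; rewrite (mulrC y^-1) uyvx mulrC.
- by case: bad; rewrite ler_pM // ltW.
- by case: bad; rewrite mulrC.
- by case: bad; rewrite ler_pM // ltW.
Qed.

Lemma curve_ratios_B : curve_B1 (x, y) \/ curve_B2 (x, y) ->
  ratios_B (x, 1, y, s).
Proof.
have vx' := vx; have vy' := vy; have uy' := uy; have ux' := ux; have s0' := s0.
have x0' := x0; have y0' := y0; have u0' := u0; have v0' := v0; have sxy' := sxy.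
have x1' := x1; have y1' := y1; have xy1' := xy1.
have xn : x != 0 by rewrite gt_eqF.
have yn : y != 0 by rewrite gt_eqF.
have sn : s != 0 by rewrite gt_eqF.
have u1 := lt_trans ux x1; have v1 := lt_trans vy y1.
move=> hB.
have xy : x < y by case: hB => -[].
have xy2 : x ^+ 2 < y ^+ 2 by rewrite ltrXn2r // ltW.
have y20 : 0 < y ^+ 2 by rewrite exprn_gt0.
have x20 : 0 < x ^+ 2 by rewrite exprn_gt0.
have hf : fB1 = 0 \/ fB2 = 0.
  by case: hB => -[_ _ _ e]; [left; rewrite fB1E e mulr0|right; rewrite fB2E].
have [sy2 x2s] : s < y ^+ 2 /\ x ^+ 2 < s.
  case: hB => -[_ _ _ e].
    (* The equation of the first family makes [y * (1 - y)] equal to [x * (1 - x) / (x + 1)], which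
       is below [1 - x]. *)
    have sy2 : s < y ^+ 2 by rewrite /s; nra.
    split=> //; have : fB1 = 0 by rewrite fB1E e mulr0.
    move/eqP; rewrite subr_eq0 => /eqP e1.
    by rewrite -subr_gt0 -(pmulr_rgt0 _ y20) e1 !mulr_gt0 // subr_gt0.
  have : fB2 = 0 by rewrite fB2E.
  move/eqP; rewrite subr_eq0 => /eqP e1.
  (* The equation gives [s - x ^+ 2] the sign of [y ^+ 2 - s]. If both were nonpositive,
     [y ^+ 2 <= s <= x ^+ 2] would contradict [x < y]. *)
  have [h|h] := ltrP s (y ^+ 2).
    by split=> //; rewrite -subr_gt0 -(pmulr_rgt0 _ y0') e1 !mulr_gt0 // subr_gt0.
  have : y * (s - x ^+ 2) <= 0.
    by rewrite e1 mulr_ge0_le0 ?subr_le0 // ltW // mulr_gt0.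
  by rewrite pmulr_rle0 // subr_le0; lra.
pose L := s / y ^+ 2; pose M := x ^+ 2 / s.
have y2n : y ^+ 2 != 0 by rewrite gt_eqF.
have Ly : L * y ^+ 2 = s by rewrite divfK.
have Ms : M * s = x ^+ 2 by rewrite divfK.
have L0 : 0 < L by exact: divr_gt0.
have M0 : 0 < M by exact: divr_gt0.
have L1 : L < 1 by rewrite ltr_pdivrMr // mul1r.
have M1 : M < 1 by rewrite ltr_pdivrMr // mul1r.
have LltM : L < M.
  rewrite -(ltr_pM2r (mulr_gt0 y20 s0')).
  have -> : L * (y ^+ 2 * s) = L * y ^+ 2 * s by ring.
  have -> : M * (y ^+ 2 * s) = M * s * y ^+ 2 by ring.
  by rewrite Ly Ms -exprMn -expr2 ltrXn2r // ltW.
have Mn1 : 1 - M != 0 by rewrite gt_eqF // subr_gt0.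
have Ln : L != 0 by rewrite gt_eqF.
have inS l m : (l, m) \in [:: (u, x); (x, u); (v, y); (y, v);
     (u^-1, x^-1); (x^-1, u^-1); (v^-1, y^-1); (y^-1, v^-1)] ->
    (l, m) \in sim_ratios (x, 1, y, s) by rewrite sim_ratios_normal.
(* Once [(1 - L) / (1 - M) = q^-1] is known, the first cross ratio is [M / L] times this value. The
   choices [x ^+ 2] and [x * y] for [q] belong to the two families. *)
have cr q : q != 0 -> q * s * (y ^+ 2 - s) = y ^+ 2 * (s - x ^+ 2) ->
    cross_ratios L M = (x ^+ 2 * y ^+ 2 / (s ^+ 2 * q), q^-1).
  move=> q0 eq.
  have e : 1 - L = q^-1 * (1 - M).
    apply: (mulfI q0); rewrite mulrA mulfV // mul1r.
    apply: (mulIf (mulf_neq0 y2n sn)).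
    transitivity (q * s * (y ^+ 2 - L * y ^+ 2)); first by ring.
    rewrite Ly eq -Ms; ring.
  rewrite /cross_ratios e; congr (_, _); last by rewrite mulfK.
  rewrite /L /M; field.
  have sx : s - x ^+ 2 != 0 by rewrite gt_eqF // subr_gt0.
  by rewrite ?q0 ?sn ?yn ?sx.
have inv1 (q : R) : 0 < q -> q < 1 -> 1 < q^-1 by move=> q0 q1; rewrite invf_gt1.
(* Both families use [(u^-1, x^-1)] as one transversal pair; the other one is the same again for B1
   and [(v^-1, y^-1)] for B2. *)
exists y, v, L, M, u^-1, x^-1.
have e12 : ratios (x, 1, y, s) = (y * L, v * M).
  by rewrite /= divr1 /L /M /v; congr (_, _); field; rewrite ?xn ?yn ?sn.
have ss : same_side [:: (y, v); (L, M)].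
  by apply/orP; left; rewrite /= y0 y1 v0 v1 L0 L1 M0 M1.
case: hf => /eqP; rewrite subr_eq0 => /eqP ef.
  exists u^-1, x^-1; split=> //.
  - by split; apply: inS; rewrite !inE eqxx ?orbT.
  - by rewrite lt_eqF.
  - rewrite (cr (x ^+ 2) (lt0r_neq0 x20) (esym ef)) /u; congr (_, _); last by rewrite expr2 invfM.
    by field; rewrite xn yn sn.
  - by split=> //; apply/orP; right; rewrite /= !inv1.
exists v^-1, y^-1; split=> //.
- by split; apply: inS; rewrite !inE eqxx ?orbT.
- by rewrite lt_eqF.
- have e : x * y * s * (y ^+ 2 - s) = y ^+ 2 * (s - x ^+ 2).
    transitivity (y * (x * s * (y ^+ 2 - s))); first by ring.
    by rewrite -ef; ring.
  rewrite (cr (x * y) (mulf_neq0 xn yn) e) /u /v; congr (_, _); last by rewrite invfM.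
  by field; rewrite xn yn sn.
- by split=> //; apply/orP; right; rewrite /= !inv1.
Qed.

End Normal.

End Numeric.

(** * Ratios of the two pieces of a single cut *)

Section Cuts.
Variable R : realType.
Implicit Types (A B C D E F u v w : 'rV[R]_2) (s t r k : R).
Implicit Types X Y H K L N : set 'rV[R]_2.

Lemma seg_seg t q A B : seg q (seg t A B) B = seg (t + q * (1 - t)) A B.
Proof. by apply: point_eq; rewrite !mxE; ring. Qed.

Lemma orient_seg_seg A B v t q :
  orient (seg t A B) v (seg q A B) = (t - q) * orient A B v.
Proof. by rewrite !orientE !mxE; ring. Qed.

Lemma areas_swap A B C D : areas B A D C =
  scale4 (-1) (orient A B C, orient D A B, orient C D A, orient B C D).
Proof.
rewrite /areas /= !mulN1r (orientC A B C) (orientC D A B) (orientC C D A).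
by rewrite (orientC B C D).
Qed.

Lemma cut_areas2 A B C D t r (u := seg t A B) (v := seg r D C) :
  [/\ orient v u B = (1 - t) * ((1 - r) * orient D A B + r * orient A B C),
      orient u B C = (1 - t) * orient A B C,
      orient B C v = (1 - r) * orient B C D &
      orient C v u = (1 - r) * ((1 - t) * orient C D A + t * orient B C D)].
Proof. by rewrite /u /v !orientE !mxE; split; ring. Qed.

Local Opaque orient.

Lemma between_ratios (c d t : R) (f := (1 - t) * d + t * c) :
  0 < c -> 0 < d -> 0 < t < 1 ->
  [/\ 0 < f, d < c -> 0 < d / f < 1 /\ 0 < f / c < 1 &
      c < d -> 1 < d / f /\ 1 < f / c].
Proof.
move=> c0 d0 /andP[t0 t1]; have t1' : 0 < 1 - t by lra.
have f0 : 0 < f by rewrite addr_gt0 // mulr_gt0.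
have h1 := mulr_gt0 t0 t1'.
split=> // cd.
  rewrite !divr_gt0 // !ltr_pdivrMr // !mul1r /f; split; nra.
rewrite !ltr_pdivlMr // !mul1r /f; split; nra.
Qed.

Lemma ratio_scale k (x y : R) : k != 0 -> (k * x) / (k * y) = x / y.
Proof. by move=> k0; rewrite -mulf_div divff // mul1r. Qed.

(** Here [f] and [g] are the areas of [C D u] and [A B v]; the factors [t], [r], [1 - t], [1 - r] in
    the areas of the pieces cancel in each ratio. *)
Lemma cut_ratiosE A B C D t r (u := seg t A B) (v := seg r D C)
    (f := (1 - t) * orient C D A + t * orient B C D)
    (g := (1 - r) * orient D A B + r * orient A B C) :
  0 < t < 1 -> 0 < r < 1 ->
  ratios (areas A u v D) = (orient C D A / f, orient D A B / g) /\
  ratios (areas u B C v) = (f / orient B C D, g / orient A B C).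
Proof.
move=> /andP[t0 t1] /andP[r0 r1].
case: (cut_areas A B C D t r) => e1 e2 e3 e4.
case: (cut_areas2 A B C D t r) => f1 f2 f3 f4.
rewrite /areas e1 e2 e3 e4 f1 f2 f3 f4.
by rewrite /= !ratio_scale // gt_eqF // subr_gt0.
Qed.

(** The intermediate areas cancel in the products. Each lies strictly between the two areas it
    interpolates, and for areas [(a, b, c, d)] the relation [c - d = b - a] puts both components on
    the same side of 1. *)
Lemma cut_ratios s A B C D t r (u := seg t A B) (v := seg r D C)
    (p := ratios (areas A u v D)) (q := ratios (areas u B C v)) :
  cvx s A B C D -> 0 < t < 1 -> 0 < r < 1 -> orient B C D != orient C D A ->
  ratios (areas A B C D) = (p.1 * q.1, p.2 * q.2) /\ same_side [:: p; q].
Proof.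
move=> hc ht hr hcd; case: (hc) => ha hb hc0 hd.
have s0 : s != 0 by apply: contraTneq ha => ->; rewrite mul0r ltxx.
have [ep eq] := cut_ratiosE A B C D ht hr.
have [f0 f1 f2] := between_ratios hc0 hd ht.
have [g0 g1 g2] := between_ratios hb ha hr.
have fE : (1 - t) * (s * orient C D A) + t * (s * orient B C D) =
  s * ((1 - t) * orient C D A + t * orient B C D) by ring.
have gE : (1 - r) * (s * orient D A B) + r * (s * orient A B C) =
  s * ((1 - r) * orient D A B + r * orient A B C) by ring.
rewrite fE in f0 f1 f2; rewrite gE in g0 g1 g2.
rewrite !ratio_scale // in f1 f2 g1 g2.
rewrite /p /q ep eq; split.
  have fn := gt0_neq0 f0; have gn := gt0_neq0 g0.
  by rewrite /= !mulrA !divfK.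
have sum := areas_sum A B C D.
have dd : s * orient B C D - s * orient C D A = s * orient A B C - s * orient D A B.
  by rewrite -!mulrBr; congr (_ * _); lra.
have hcd' : s * orient B C D != s * orient C D A by rewrite (inj_eq (mulfI s0)).
apply/orP; rewrite /= !andbT; case: (ltgtP (s * orient B C D) (s * orient C D A)) hcd' => // lt _.
  by right; case: f2 => // -> ->; case: g2 => [|-> ->] //; lra.
by left; case: f1 => // -> ->; case: g1 => [|-> ->] //; lra.
Qed.

(* The parameter of a cut with given ratios is read off from
   d = l L c and (1 - t) d + t c = L c. *)
Lemma cut_parameter (l L : R) (t := L * (1 - l) / (1 - l * L)) :
  (0 < l < 1 /\ 0 < L < 1) \/ (1 < l /\ 1 < L) ->
  [/\ 0 < t < 1, l != 0 & forall c d, d = l * L * c -> (1 - t) * d + t * c = L * c].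
Proof.
move=> h; have l0 : l != 0 by case: h => -[]; [move=> /andP[/gt_eqF ->]|lra].
have n0 : 1 - l * L != 0.
  case: h => [[/andP[l1 l2] /andP[L1 L2]]|[l1 L1]].
    by rewrite subr_eq0 gt_eqF // mulr_ilt1 // ltW.
  by rewrite subr_eq0 lt_eqF // mulr_egt1.
split=> //; last by move=> c d ->; rewrite /t; field.
case: h => [[/andP[l1 l2] /andP[L1 L2]]|[l1 L1]].
  have p : 0 < 1 - l * L by rewrite subr_gt0 mulr_ilt1 // ltW.
  apply/andP; split; first by rewrite divr_gt0 // mulr_gt0 // subr_gt0.
  by rewrite ltr_pdivrMr //; lra.
have p : 0 < l * L - 1 by rewrite subr_gt0 mulr_egt1.
have -> : t = L * (l - 1) / (l * L - 1).
  by rewrite /t; field; rewrite n0 gt_eqF.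
apply/andP; split; last by rewrite ltr_pdivrMr //; lra.
by rewrite divr_gt0 // mulr_gt0 ?subr_gt0 // (lt_trans ltr01).
Qed.

(** The two ends can be chosen independently: [l] and [L] determine the parameter on [AB], [m] and
    [M] that on [DC]. *)
Lemma cut_exists s A B C D (l m L M : R) : cvx s A B C D ->
  ratios (areas A B C D) = (l * L, m * M) -> same_side [:: (l, m); (L, M)] ->
  exists t r, [/\ 0 < t < 1, 0 < r < 1,
    ratios (areas A (seg t A B) (seg r D C) D) = (l, m) &
    ratios (areas (seg t A B) B C (seg r D C)) = (L, M)].
Proof.
move=> hc [e1 e2] hs; case: (hc) => /gt0_neq0 a0 /gt0_neq0 b0 /gt0_neq0 c0 /gt0_neq0 d0.
have ed : orient C D A = l * L * orient B C D by rewrite -e1 divfK.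
have ea : orient D A B = m * M * orient A B C by rewrite -e2 divfK.
have h1 : (0 < l < 1 /\ 0 < L < 1) \/ (1 < l /\ 1 < L).
  by move: hs; rewrite /same_side /= !andbT => /orP[/andP[/andP[? ?] /andP[? ?]]|
    /andP[/andP[? ?] /andP[? ?]]]; [left|right].
have h2 : (0 < m < 1 /\ 0 < M < 1) \/ (1 < m /\ 1 < M).
  by move: hs; rewrite /same_side /= !andbT => /orP[/andP[/andP[? ?] /andP[? ?]]|
    /andP[/andP[? ?] /andP[? ?]]]; [left|right].
have [ht l0 ft] := cut_parameter h1; have [hr m0 fr] := cut_parameter h2.
exists (L * (1 - l) / (1 - l * L)), (M * (1 - m) / (1 - m * M)).
have [-> ->] := cut_ratiosE A B C D ht hr.
rewrite (ft _ _ ed) (fr _ _ ea); split=> //; congr (_, _).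
- apply: (canLR (mulfK _)); last by rewrite ed mulrA.
  by apply: contra d0; rewrite ed -mulrA => /eqP ->; rewrite mulr0.
- apply: (canLR (mulfK _)); last by rewrite ea mulrA.
  by apply: contra a0; rewrite ea -mulrA => /eqP ->; rewrite mulr0.
- by rewrite mulfK.
- by rewrite mulfK.
Qed.

Lemma splitsC X u v H K : splits X u v H K -> splits X v u H K.
Proof.
have sw Y Z : chord_cut X u v Y Z -> chord_cut X v u Z Y.
  case=> bu bv os eY eZ; split=> //; first by rewrite open_segmentC.
    by rewrite eZ; congr (_ `&` _); apply/seteqP; split=> w /=;
      rewrite (orientN u v) oppr_ge0.
  by rewrite eY; congr (_ `&` _); apply/seteqP; split=> w /=;
      rewrite (orientN u v) oppr_le0.
by case=> /sw; [right|left].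
Qed.

(** The hull is closed, so its boundary points belong to it. This locates the ends of a second
    cut. *)
Lemma splits_mem s A B C D u v H K : cvx s A B C D ->
  splits (hull A B C D) u v H K -> hull A B C D u /\ hull A B C D v.
Proof.
move=> hc; have cl x : boundary (hull A B C D) x -> hull A B C D x.
  by case=> + _; rewrite -(iffLR (closure_id _) (hull_closed hc)).
by case=> -[/cl ? /cl ? _ _ _].
Qed.

End Cuts.

(** * Equivalence of the two types of dissection with the numerical conditions *)

Section CutTypes.
Variable R : realType.
Implicit Types (A B C D E F u v w : 'rV[R]_2) (s t r k : R).
Implicit Types X Y H K L N : set 'rV[R]_2.

Definition cut_A A B C D Ps := exists u1 v1 u2 v2,
  [/\ open_segment A B u1 /\ open_segment C D v1,
      open_segment A B u2 /\ open_segment C D v2,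
      closed_segment u1 v1 `&` closed_segment u2 v2 = set0 &
      glass_cut (hull A B C D) [:: (u1, v1); (u2, v2)] Ps].

Definition cut_B A B C D Ps := exists u1 v1 u2 v2,
  [/\ open_segment A B u1 /\ open_segment C D v1,
      open_segment u1 v1 u2,
      open_segment B C v2 \/ open_segment D A v2 &
      glass_cut (hull A B C D) [:: (u1, v1); (u2, v2)] Ps].

Definition admits (cut : seq (set 'rV[R]_2) -> Prop) A B C D :=
  exists Ps, self_affinity 3 (hull A B C D) Ps /\ cut Ps.

Local Opaque orient.

Lemma closed_segment_ends u v : closed_segment u v u /\ closed_segment u v v.
Proof.
split; [exists 0|exists 1]; rewrite /= ?in_itv /= ?lexx ?ler01 //.
  by rewrite subr0 scale1r scale0r addr0.
by rewrite subrr scale0r scale1r add0r.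
Qed.

Lemma cross_ratios_rot (a b c d : R) : nondeg (a, b, c, d) ->
  ratios (b, c, d, a) = cross_ratios (d / c) (a / b).
Proof.
case/and5P => a0 b0 c0 d0 /and3P[/eqP e cd ad].
have eb : b = a + c - d by rewrite e addrK.
have ab : b - a = c - d by rewrite eb; ring.
have cd0 : c - d != 0 by rewrite subr_eq0.
have e1 : 1 - d / c = (c - d) / c by rewrite mulrBl divff.
have e2 : 1 - a / b = (c - d) / b by rewrite -ab mulrBl divff.
rewrite /cross_ratios e1 e2 /=; congr (_, _); field; rewrite ?a0 ?b0 ?c0 ?d0 ?cd0 //.
Qed.

Lemma same_side3 (l1 m1 l2 m2 l3 m3 : R) :
  same_side [:: (l1, m1); (l2 * l3, m2 * m3)] ->
  same_side [:: (l2, m2); (l3, m3)] ->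
  same_side [:: (l1, m1); (l2, m2); (l3, m3)].
Proof.
rewrite /same_side /= !andbT => h1 h2; apply/orP.
case/orP: h1 => [/andP[-> /andP[/andP[_ p1] _]]|/andP[-> /andP[p1 _]]];
  case/orP: h2 => [/andP[h2 h3]|/andP[h2 h3]].
- by left; rewrite h2 h3.
- have : 1 < l2 * l3 by case/andP: h2 => ? _; case/andP: h3 => ? _; rewrite mulr_egt1.
  by move=> p2; move: (lt_trans p1 p2); rewrite ltxx.
- have : l2 * l3 < 1.
    case/andP: h2 => /andP[? ?] _; case/andP: h3 => /andP[? ?] _.
    by rewrite mulr_ilt1 // ltW.
  by move=> p2; move: (lt_trans p1 p2); rewrite ltxx.
- by right; rewrite h2 h3.
Qed.

Lemma side_gt0 s A B C D r : cvx s A B C D -> 0 < r < 1 ->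
  0 < s * orient A B (seg r D C).
Proof.
case=> ha hb _ _ /andP[r0 r1].
rewrite orient_comb (orient_rot D) mulrDr !(mulrCA s) addr_gt0 // mulr_gt0 //.
by rewrite subr_gt0.
Qed.

Lemma orient_seg_seg2 C D u r q :
  orient u (seg r D C) (seg q D C) = (r - q) * orient C D u.
Proof. by rewrite !orientE !mxE; ring. Qed.

Lemma opposite_side_gt0 s A B C D t : cvx s A B C D -> 0 < t < 1 ->
  0 < s * orient C D (seg t A B).
Proof.
by move=> hc ht; rewrite segC; apply: (side_gt0 (cvx_rot (cvx_rot hc))); lra.
Qed.

Lemma cvx_sign_neq0 s A B C D : cvx s A B C D -> s != 0.
Proof. by case=> + _ _ _; apply: contraTneq => ->; rewrite mul0r ltxx. Qed.

(** This treats a second cut in the piece next to [BC]; the other case is its mirror image. *)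
Lemma cut_A_ratios_piece s A B C D t r u2 v2 L N
    (u1 := seg t A B) (v1 := seg r D C) :
  cvx s A B C D -> nondeg (areas A B C D) -> 0 < t < 1 -> 0 < r < 1 ->
  open_segment A B u2 -> open_segment C D v2 ->
  closed_segment u1 v1 `&` closed_segment u2 v2 = set0 ->
  splits (hull u1 B C v1) u2 v2 L N ->
  affine_image (hull A B C D) (hull A u1 v1 D) ->
  affine_image (hull A B C D) L -> affine_image (hull A B C D) N ->
  ratios_A (areas A B C D).
Proof.
move=> hc nd ht hr /open_segmentP[t2 [/andP[t20 t21] eu2]].
rewrite open_segmentC => /open_segmentP[r2 [/andP[r20 r21] ev2]] dis spl aH aL aN.
have [t0 t1] := andP ht; have [r0 r1] := andP hr.
have hc1 := cut_cvx hc ht hr; have hc2 := cut_cvx2 hc ht hr.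
have hcd : orient B C D != orient C D A.
  by move: nd => /and5P[_ _ _ _ /and3P[_ h _]].
have [eq1 ss1] := cut_ratios hc ht hr hcd.
have [Ku Kv] := splits_mem hc2 spl.
have st (x y z : R) : 0 < s * z -> s * ((x - y) * z) <= 0 -> x <= y.
  by move=> hz; rewrite mulrCA pmulr_lle0 // subr_le0.
(* The ends of the second cut belong to the far piece, so they do not come before those of the
   first. *)
have le_t : t <= t2.
  move: Ku; rewrite /u1 /v1 (hull_cut2 hc ht hr) => -[_ /=].
  by rewrite eu2 orient_seg_seg; apply: st; exact: side_gt0 hc hr.
have le_r : r <= r2.
  move: Kv; rewrite /u1 /v1 (hull_cut2 hc ht hr) => -[_ /=].
  by rewrite ev2 orient_seg_seg2; apply: st; exact: opposite_side_gt0 hc ht.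
have [cu1 cv1] := closed_segment_ends u1 v1.
have [cu2 cv2] := closed_segment_ends u2 v2.
(* Equality would give the two cuts a common end. *)
have lt_t : t < t2.
  rewrite lt_neqAle le_t andbT; apply/eqP => e.
  have : (closed_segment u1 v1 `&` closed_segment u2 v2) u1.
    by split=> //; rewrite /u1 e -eu2.
  by rewrite dis.
have lt_r : r < r2.
  rewrite lt_neqAle le_r andbT; apply/eqP => e.
  have : (closed_segment u1 v1 `&` closed_segment u2 v2) v1.
    by split=> //; rewrite /v1 e -ev2.
  by rewrite dis.
(* Parameters of the second cut relative to the sides of the remaining piece. *)
pose q := (t2 - t) / (1 - t); pose w := (r2 - r) / (1 - r).
have t1n : 0 < 1 - t by rewrite subr_gt0.
have r1n : 0 < 1 - r by rewrite subr_gt0.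
have hq : 0 < q < 1.
  by apply/andP; split; rewrite ?divr_gt0 ?ltr_pdivrMr ?subr_gt0 //; lra.
have hw : 0 < w < 1.
  by apply/andP; split; rewrite ?divr_gt0 ?ltr_pdivrMr ?subr_gt0 //; lra.
have eu : u2 = seg q u1 B.
  by rewrite eu2 seg_seg; congr seg; rewrite /q divfK ?gt_eqF //; ring.
have ev : v2 = seg w v1 C.
  by rewrite ev2 seg_seg; congr seg; rewrite /w divfK ?gt_eqF //; ring.
have [aP aQ] : affine_image (hull A B C D) (hull u1 u2 v2 v1) /\
    affine_image (hull A B C D) (hull u2 B C v2).
  move: spl; rewrite eu ev => /(splitsP _ _ hc2 hq hw).
  by case=> -[eL eN]; rewrite -eL -eN.
rewrite eu ev in aP aQ.
have pS := affine_image_ratiosP hc hc1 nd aH.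
have p2S := affine_image_ratiosP hc (cut_cvx hc2 hq hw) nd aP.
have p3S := affine_image_ratiosP hc (cut_cvx2 hc2 hq hw) nd aQ.
have hcd2 : orient B C v1 != orient C v1 u1.
  have [_ _ + _] : [/\ (ratios (areas u1 B C v1)).1 != 0,
      (ratios (areas u1 B C v1)).2 != 0, (ratios (areas u1 B C v1)).1 != 1 &
      (ratios (areas u1 B C v1)).2 != 1].
    by apply: (@same_side_neq _ (ratios (areas A u1 v1 D)).1
      (ratios (areas A u1 v1 D)).2); rewrite -!surjective_pairing.
  apply: contra => /eqP e; rewrite /= -e divff //.
  by case: hc2 => _ _ /gt0_neq0.
have [eq2 ss2] := cut_ratios hc2 hq hw hcd2.
rewrite -/u1 -/v1 eq2 in ss1 eq1.
move: pS p2S p3S eq1 ss1 ss2; rewrite -/u1 -/v1.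
set P1 := ratios (areas A u1 v1 D); set P2 := ratios (areas u1 _ _ _).
set P3 := ratios (areas (seg q u1 B) B C (seg w v1 C)).
case: P1 P2 P3 => [l1 m1] [l2 m2] [l3 m3] /= h1 h2 h3 e ss1 ss2.
exists l1, m1, l2, m2, l3, m3; split=> //.
exact: same_side3.
Qed.

Lemma nondeg_swap A B C D : nondeg (areas A B C D) -> nondeg (areas B A D C).
Proof.
case/and5P => a0 b0 c0 d0 /and3P[/eqP e cd ad].
rewrite areas_swap /= !mulN1r !oppr_eq0 a0 b0 c0 d0 !eqr_opp (eq_sym _ (orient B C D)) cd.
rewrite -!opprD eqr_opp e eqxx /=.
apply: contra ad => /eqP bc.
by move/eqP: e; rewrite bc addrC (inj_eq (addrI _)) eq_sym.
Qed.

Lemma cut_A_ratios s A B C D : cvx s A B C D -> nondeg (areas A B C D) ->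
  admits (cut_A A B C D) A B C D -> ratios_A (areas A B C D).
Proof.
move=> hc nd [Ps [sa [u1 [v1 [u2 [v2 [[ou1 ov1] [ou2 ov2] dis gl]]]]]]].
have [H [K [L [N [s1 s2 [aH aL aN]]]]]] :=
  iffLR (glass_cut2P _ _ _ _ _) (ex_intro _ Ps (conj sa gl)).
move: ou1 => /open_segmentP[t [ht eu1]].
move: (ov1); rewrite open_segmentC => /open_segmentP[r [hr ev1]].
rewrite eu1 ev1 in s1 dis.
case: (iffLR (splitsP _ _ hc ht hr) s1) => -[eH eK]; rewrite eH eK in s2 aH *.
  exact: (cut_A_ratios_piece hc nd ht hr ou2 ov2 dis s2).
have hts : 0 < 1 - t < 1 by lra.
have hrs : 0 < 1 - r < 1 by lra.
(* The second cut lies in the piece next to [DA], which the mirror relabelling turns into the far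
   piece. *)
suff : ratios_A (areas B A D C).
  rewrite areas_swap ratios_A_scale ?oppr_eq0 ?oner_eq0 //.
  exact: ratios_A_swap.
apply: (@cut_A_ratios_piece (- s) B A D C (1 - t) (1 - r) u2 v2 L N) => //.
- exact: cvx_swap.
- exact: nondeg_swap.
- by rewrite open_segmentC.
- by rewrite open_segmentC.
- by rewrite -(segC t A B) -(segC r D C).
- by rewrite -(segC t A B) -(segC r D C) -(hull_swap A).
- by rewrite -(segC t A B) -(segC r D C) -(hull_swap A) -(hull_swap _ B C).
- by rewrite -(hull_swap A).
- by rewrite -(hull_swap A).
Qed.

Lemma ratios_cut_A s A B C D : cvx s A B C D -> nondeg (areas A B C D) ->
  ratios_A (areas A B C D) -> admits (cut_A A B C D) A B C D.
Proof.
move=> hc nd [l1 [m1 [l2 [m2 [l3 [m3 [[h1 h2 h3] e hs]]]]]]].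
(* The second and third pieces are first taken together and then separated by the second cut. *)
have [ss1 ss2] : same_side [:: (l1, m1); (l2 * l3, m2 * m3)] /\
    same_side [:: (l2, m2); (l3, m3)].
  move: hs; rewrite /same_side /= !andbT => /orP[/and3P[-> p2 p3]|/and3P[-> p2 p3]].
    rewrite p2 p3; split=> //; apply/orP; left.
    move: p2 p3 => /andP[/andP[? ?] /andP[? ?]] /andP[/andP[? ?] /andP[? ?]].
    by rewrite !mulr_gt0 // !mulr_ilt1 // ltW.
  rewrite p2 p3; split; rewrite ?orbT //; apply/orP; right.
  by move: p2 p3 => /andP[? ?] /andP[? ?]; rewrite !mulr_egt1.
have [t [r [ht hr ep eK]]] := cut_exists hc e ss1.
have hc1 := cut_cvx hc ht hr; have hc2 := cut_cvx2 hc ht hr.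
have [q [w [hq hw ep2 ep3]]] := cut_exists hc2 eK ss2.
set u1 := seg t A B in ep eK ep2 ep3 hc1 hc2 *.
set v1 := seg r D C in ep eK ep2 ep3 hc1 hc2 *.
have [t0 t1] := andP ht; have [r0 r1] := andP hr.
have [q0 q1] := andP hq; have [w0 w1] := andP hw.
have out (x y : R) : 0 < x -> x < 1 -> 0 < y -> y < 1 -> 0 < x + y * (1 - x) < 1.
  by move=> *; apply/andP; split; nra.
have [Ps [sa gl]] :
    exists Ps, self_affinity 3 (hull A B C D) Ps /\
      glass_cut (hull A B C D) [:: (u1, v1); (seg q u1 B, seg w v1 C)] Ps.
  apply/glass_cut2P.
  exists (hull A u1 v1 D), (hull u1 B C v1), (hull u1 (seg q u1 B) (seg w v1 C) v1),
    (hull (seg q u1 B) B C (seg w v1 C)); split.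
  - by apply/(splitsP _ _ hc ht hr); left.
  - by apply/(splitsP _ _ hc2 hq hw); left.
  - split; apply: (ratios_affine_image hc _ nd).
    + exact: hc1.
    + by rewrite ep.
    + exact: (cut_cvx hc2 hq hw).
    + by rewrite ep2.
    + exact: (cut_cvx2 hc2 hq hw).
    + by rewrite ep3.
exists Ps; split=> //; exists u1, v1, (seg q u1 B), (seg w v1 C); split=> //.
- split; first by apply/open_segmentP; exists t.
  by rewrite open_segmentC; apply/open_segmentP; exists r.
- split; first by apply/open_segmentP; exists (t + q * (1 - t)); rewrite -seg_seg out.
  by rewrite open_segmentC; apply/open_segmentP; exists (r + w * (1 - r)); rewrite -seg_seg out.
(* Every point of the second cut lies strictly on the far side of the line through [u1] and [v1]. *)
apply/seteqP; split=> // z [[a _ <-] [b /=]].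
rewrite in_itv /= => /andP[b0 b1] e2.
have : orient u1 v1 ((1 - a) *: u1 + a *: v1) = 0.
  by rewrite orient_comb orientABA orientABB !mulr0 addr0.
rewrite -e2 orient_comb {1}/u1 {2}/v1 !seg_seg orient_seg_seg orient_seg_seg2.
have g1 := side_gt0 hc hr; have g2 := opposite_side_gt0 hc ht.
move=> e0; have : s * ((1 - b) * ((t - (t + q * (1 - t))) * orient A B v1) +
   b * ((r - (r + w * (1 - r))) * orient C D u1)) = 0 by rewrite e0 mulr0.
have -> : s * ((1 - b) * ((t - (t + q * (1 - t))) * orient A B v1) +
   b * ((r - (r + w * (1 - r))) * orient C D u1)) =
  - ((1 - b) * (q * (1 - t) * (s * orient A B v1)) +
     b * (w * (1 - r) * (s * orient C D u1))) by ring.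
move/eqP; rewrite oppr_eq0 gt_eqF //.
have p1 : 0 < q * (1 - t) * (s * orient A B v1).
  by apply: mulr_gt0 => //; apply: mulr_gt0 => //; rewrite subr_gt0.
have p2 : 0 < w * (1 - r) * (s * orient C D u1).
  by apply: mulr_gt0 => //; apply: mulr_gt0 => //; rewrite subr_gt0.
have [b2|b2] := eqVneq b 0.
  by rewrite b2 mul0r addr0 subr0 mul1r.
apply: ltr_wpDl; last by apply: mulr_gt0 => //; rewrite lt0r b2.
by apply: mulr_ge0; [rewrite subr_ge0|exact: ltW].
Qed.

Lemma cut_B_ratios_piece s A B C D t r u2 v2 H K L N
    (u1 := seg t A B) (v1 := seg r D C) :
  cvx s A B C D -> nondeg (areas A B C D) -> 0 < t < 1 -> 0 < r < 1 ->
  splits (hull A B C D) u1 v1 H K ->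
  open_segment u1 v1 u2 -> open_segment B C v2 -> splits K u2 v2 L N ->
  affine_image (hull A B C D) H -> affine_image (hull A B C D) L ->
  affine_image (hull A B C D) N -> ratios_B (areas A B C D).
Proof.
move=> hc nd ht hr spl /open_segmentP[w [hw eu2]] /open_segmentP[q [hq ev2]] spl2 aH aL aN.
have hc1 := cut_cvx hc ht hr; have hc2 := cut_cvx2 hc ht hr.
rewrite -/u1 -/v1 in hc1 hc2.
have [ka kb kc kd] := hc2.
(* A second cut inside [A u1 v1 D] could not end on [BC], which lies strictly beyond the chord. *)
case: (iffLR (splitsP _ _ hc ht hr) spl) => -[eH eK]; last first.
  exfalso; rewrite eK in spl2; have [_] := splits_mem hc1 spl2.
  rewrite /u1 /v1 (hull_cut hc ht hr) => -[_ /=]; rewrite -/u1 -/v1.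
  rewrite ev2 orient_comb (orientN v1 u1) (orientC C v1 u1).
  have [q0 q1] := andP hq; have q1' : 0 < 1 - q by rewrite subr_gt0.
  rewrite !mulrN -opprD mulrN oppr_ge0 mulrDr !(mulrCA s).
  have h1 := mulr_gt0 q1' ka; have h2 := mulr_gt0 q0 kd; lra.
(* Read as [B C v1 u1], the remainder is again cut between its first side and the opposite one. *)
have hcR := cvx_rot hc2.
have [aP aQ] : affine_image (hull A B C D) (hull B v2 u2 u1) /\
    affine_image (hull A B C D) (hull v2 C v1 u2).
  move: spl2; rewrite eK -/u1 -/v1 hull_rot eu2 ev2.
  move=> /splitsC /(splitsP _ _ hcR hq hw).
  by case=> -[eL eN]; rewrite -eL -eN.
rewrite ev2 eu2 in aP aQ; rewrite eH in aH.
have pS := affine_image_ratiosP hc hc1 nd aH.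
have p2S := affine_image_ratiosP hc (cut_cvx hcR hq hw) nd aP.
have p3S := affine_image_ratiosP hc (cut_cvx2 hcR hq hw) nd aQ.
have hcd : orient B C D != orient C D A.
  by move: nd => /and5P[_ _ _ _ /and3P[_ h _]].
have [eq1 ss1] := cut_ratios hc ht hr hcd.
rewrite -/u1 -/v1 in eq1 ss1.
(* Were [BC] parallel to the chord, the piece at [B] would have a ratio equal to 1. *)
have hcdR : orient C v1 u1 != orient v1 u1 B.
  apply/eqP => e; move: p2S.
  have [-> _] := cut_ratiosE B C v1 u1 hq hw.
  rewrite e -mulrDl subrK mul1r divff ?(gt0_neq0 ka) //.
  by move/(nondeg_sim_ratios nd); rewrite eqxx.
have [L0 M0 L1 M1] : [/\ (ratios (areas u1 B C v1)).1 != 0,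
      (ratios (areas u1 B C v1)).2 != 0, (ratios (areas u1 B C v1)).1 != 1 &
      (ratios (areas u1 B C v1)).2 != 1].
  by apply: (@same_side_neq _ (ratios (areas A u1 v1 D)).1
      (ratios (areas A u1 v1 D)).2); rewrite -!surjective_pairing.
have ndK : nondeg (areas u1 B C v1).
  rewrite /= (gt0_neq0 ka) (gt0_neq0 kb) (gt0_neq0 kc) (gt0_neq0 kd) areas_sum eqxx.
  rewrite (eq_sym (orient v1 u1 B)) hcdR andbT /=.
  by apply: contra L1 => /eqP e; rewrite /= -e divff // (gt0_neq0 kc).
have ecr := cross_ratios_rot ndK.
have [eq2 ss2] := cut_ratios hcR hq hw hcdR.
have LM : (ratios (areas u1 B C v1)).1 != (ratios (areas u1 B C v1)).2.
  apply/eqP => /= e; case/eqP: hcdR; rewrite /= in L0 L1.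
  move: ecr => -[+ _]; rewrite -e divff; last first.
    by rewrite mulf_neq0 // subr_eq0 eq_sym.
  by move=> e1; rewrite -[RHS](divfK (gt0_neq0 kd)) e1 mul1r.
move: eq2 ss2; rewrite /areas -/(areas u1 B C v1) => eq2 ss2.
rewrite ecr in eq2.
exists (ratios (areas A u1 v1 D)).1, (ratios (areas A u1 v1 D)).2,
  (ratios (areas u1 B C v1)).1, (ratios (areas u1 B C v1)).2,
  (ratios (areas B (seg q B C) (seg w u1 v1) u1)).1,
  (ratios (areas B (seg q B C) (seg w u1 v1) u1)).2,
  (ratios (areas (seg q B C) C v1 (seg w u1 v1))).1,
  (ratios (areas (seg q B C) C v1 (seg w u1 v1))).2.
split=> //; rewrite -!surjective_pairing //.
Qed.

Lemma cut_B_ratios s A B C D : cvx s A B C D -> nondeg (areas A B C D) ->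
  admits (cut_B A B C D) A B C D -> ratios_B (areas A B C D).
Proof.
move=> hc nd [Ps [sa [u1 [v1 [u2 [v2 [[ou1 ov1] ou2 ov2 gl]]]]]]].
have [H [K [L [N [s1 s2 [aH aL aN]]]]]] :=
  iffLR (glass_cut2P _ _ _ _ _) (ex_intro _ Ps (conj sa gl)).
move: ou1 => /open_segmentP[t [ht eu1]].
move: (ov1); rewrite open_segmentC => /open_segmentP[r [hr ev1]].
rewrite eu1 ev1 in s1 ou2.
case: ov2 => ov2; first exact: (cut_B_ratios_piece hc nd ht hr s1 ou2 ov2 s2).
have hts : 0 < 1 - t < 1 by lra.
have hrs : 0 < 1 - r < 1 by lra.
suff : ratios_B (areas B A D C).
  rewrite areas_swap ratios_B_scale ?oppr_eq0 ?oner_eq0 //.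
  exact: ratios_B_swap.
apply: (@cut_B_ratios_piece (- s) B A D C (1 - t) (1 - r) u2 v2 H K L N) => //.
- exact: cvx_swap.
- exact: nondeg_swap.
- by rewrite -(segC t A B) -(segC r D C) -(hull_swap A).
- by rewrite -(segC t A B) -(segC r D C).
- by rewrite open_segmentC.
- by rewrite -(hull_swap A).
- by rewrite -(hull_swap A).
- by rewrite -(hull_swap A).
Qed.

Lemma ratios_cut_B s A B C D : cvx s A B C D -> nondeg (areas A B C D) ->
  ratios_B (areas A B C D) -> admits (cut_B A B C D) A B C D.
Proof.
move=> hc nd [l [m [L [M [p1 [q1 [p2 [q2 [[h1 h2 h3] e LM ecr [ss1 ss2]]]]]]]]]].
have [t [r [ht hr ep eK]]] := cut_exists hc e ss1.
have hc1 := cut_cvx hc ht hr; have hc2 := cut_cvx2 hc ht hr.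
set u1 := seg t A B in ep eK hc1 hc2 *.
set v1 := seg r D C in ep eK hc1 hc2 *.
have [ka kb kc kd] := hc2.
have [L0 M0 L1 M1] := same_side_neq ss1.
have hcR := cvx_rot hc2.
have [eL eM] := eK.
have ndK : nondeg (areas u1 B C v1).
  rewrite /= (gt0_neq0 ka) (gt0_neq0 kb) (gt0_neq0 kc) (gt0_neq0 kd) areas_sum eqxx /=.
  apply/andP; split.
    by apply: contra L1 => /eqP e1; rewrite -eL -e1 divff // (gt0_neq0 kc).
  (* [L != M] keeps [BC] and the chord from being parallel. *)
  apply: contra LM => /eqP e1; have := areas_sum u1 B C v1.
  by rewrite -eL -eM e1 [RHS]addrC => /addrI ->.
have ecr' := cross_ratios_rot ndK.
rewrite eL eM ecr in ecr'.
have [q [w [hq hw ep2 ep3]]] := cut_exists hcR ecr' ss2.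
have [Ps [sa gl]] :
    exists Ps, self_affinity 3 (hull A B C D) Ps /\
      glass_cut (hull A B C D) [:: (u1, v1); (seg w u1 v1, seg q B C)] Ps.
  apply/glass_cut2P.
  exists (hull A u1 v1 D), (hull u1 B C v1), (hull B (seg q B C) (seg w u1 v1) u1),
    (hull (seg q B C) C v1 (seg w u1 v1)); split.
  - by apply/(splitsP _ _ hc ht hr); left.
  - by apply: splitsC; rewrite hull_rot; apply/(splitsP _ _ hcR hq hw); left.
  - split; apply: (ratios_affine_image hc _ nd).
    + exact: hc1.
    + by rewrite ep.
    + exact: (cut_cvx hcR hq hw).
    + by rewrite ep2.
    + exact: (cut_cvx2 hcR hq hw).
    + by rewrite ep3.
exists Ps; split=> //; exists u1, v1, (seg w u1 v1), (seg q B C); split=> //.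
- split; first by apply/open_segmentP; exists t.
  by rewrite open_segmentC; apply/open_segmentP; exists r.
- by apply/open_segmentP; exists w.
- by left; apply/open_segmentP; exists q.
Qed.

End CutTypes.

(** * From indexed vertices to labelled quadrangles; normal form of the affine type *)

Section Quadrangle.
Variable R : realType.
Implicit Types (A B C D : 'rV[R]_2) (s k x y : R) (p : 'I_4 -> 'rV[R]_2).
Implicit Types (i j e : 'I_4).

Lemma I4E i :
  [/\ i + 1 + 1 = i + 2, i + 1 + 2 = i + 3, i + 1 + 3 = i & i + 2 + 1 = i + 3] /\
  [/\ i + 2 + 2 = i, i + 2 + 3 = i + 1 & i + 3 + 1 = i].
Proof.
by case: i => [[|[|[|[|//]]]] ?]; split; split; apply: val_inj.
Qed.

Lemma region_hull p : region p = hull (p 0) (p 1) (p 2) (p 3).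
Proof.
have e (t : 'I_4 -> R) : \sum_i t i *: p i = t 0 *: p 0 + t 1 *: p 1 + t 2 *: p 2 + t 3 *: p 3.
  rewrite !big_ord_recl big_ord0 addr0 !addrA.
  by congr (_ + _ + _ + _); congr (t _ *: p _); apply: val_inj.
have e1 (t : 'I_4 -> R) : \sum_i t i = t 0 + t 1 + t 2 + t 3.
  rewrite !big_ord_recl big_ord0 addr0 !addrA.
  by congr (_ + _ + _ + _); congr (t _); apply: val_inj.
apply/seteqP; split=> w.
  case=> t /= [t0 t1] <-; exists (t 0), (t 1), (t 2), (t 3).
  by split; [split; exact: t0|rewrite -e1|exact: e].
case=> a [b [c [d [[a0 b0 c0 d0] h1 ->]]]].
pose t (i : 'I_4) := nth 0 [:: a; b; c; d] i.
exists t; last by rewrite e.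
split; last by rewrite e1.
by case=> [[|[|[|[|//]]]] ?].
Qed.

Lemma hull_at p i : hull (p i) (p (i + 1)) (p (i + 2)) (p (i + 3)) = region p.
Proof.
rewrite region_hull; case: i => [[|[|[|[|//]]]] hi].
- by congr hull; congr p; apply: val_inj.
- by rewrite (hull_rot (p 0)); congr hull; congr p; apply: val_inj.
- by rewrite (hull_rot (p 0)) (hull_rot (p 1)); congr hull; congr p; apply: val_inj.
- rewrite (hull_rot (p 0)) (hull_rot (p 1)) (hull_rot (p 2)).
  by congr hull; congr p; apply: val_inj.
Qed.

(** With the area at [p (i + 1)] as sign, three of the convexity conditions say that cyclically
    adjacent areas agree in sign, which propagates to all four. *)
Lemma cvx_at p i : convex_quadrangle p ->
  exists s, cvx s (p i) (p (i + 1)) (p (i + 2)) (p (i + 3)).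
Proof.
move=> h; exists (orient (p i) (p (i + 1)) (p (i + 2))).
have h1 := h i; have h2 := h (i + 1); have h3 := h (i + 2).
case: (I4E i) => -[e1 e2 e3 e4] [e5 e6 e7].
rewrite e1 e2 e3 in h2; rewrite e4 e5 e6 in h3.
move: h1 h2 h3.
rewrite (orient_rot (p (i + 3)) (p i)) (orient_rot (p i) (p (i + 1))).
rewrite (orient_rot (p (i + 1)) (p (i + 2))).
set a := orient (p (i + 3)) _ _; set b := orient (p i) _ _.
set c := orient (p (i + 1)) _ _; set d := orient (p (i + 2)) _ _.
move=> h1 h2 h3; have b0 : b != 0 by apply: contraTneq h1 => ->; rewrite mul0r ltxx.
have c0 : c != 0 by apply: contraTneq h2 => ->; rewrite mul0r ltxx.
split=> //.
- by rewrite -expr2 exprn_even_gt0.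
- by rewrite mulrC.
- have c2 : 0 < c ^+ 2 by rewrite exprn_even_gt0.
  rewrite -(pmulr_lgt0 _ c2).
  have -> : b * d * c ^+ 2 = c * b * (d * c) by ring.
  exact: mulr_gt0.
Qed.

(** Two areas over a common side differ, up to sign, by the cross product of that side with the
    opposite one. *)
Lemma nondeg_at p i : convex_quadrangle p -> ~ trapezoid p ->
  nondeg (areas (p i) (p (i + 1)) (p (i + 2)) (p (i + 3))).
Proof.
move=> hc ht; have [s hs] := cvx_at i hc.
case: (I4E i) => -[e1 e2 e3 e4] [e5 e6 e7].
have ab : orient (p (i + 3)) (p i) (p (i + 1)) != orient (p i) (p (i + 1)) (p (i + 2)).
  apply: contra_notN ht => /eqP ab; exists i.
  by move/eqP: ab; rewrite -subr_eq0 => /eqP <-; rewrite !orientE /cross !mxE; ring.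
have bc : orient (p i) (p (i + 1)) (p (i + 2)) != orient (p (i + 1)) (p (i + 2)) (p (i + 3)).
  apply: contra_notN ht => /eqP bc; exists (i + 1); rewrite e1 e2 e3.
  by move/eqP: bc; rewrite -subr_eq0 => /eqP <-; rewrite !orientE /cross !mxE; ring.
have sum := areas_sum (p i) (p (i + 1)) (p (i + 2)) (p (i + 3)).
case: hs => /gt0_neq0 a0 /gt0_neq0 b0 /gt0_neq0 c0 /gt0_neq0 d0.
rewrite /= a0 b0 c0 d0 sum eqxx /=; apply/andP; split.
  by apply: contra ab => /eqP e; move/eqP: sum; rewrite e (inj_eq (addIr _)).
apply: contra bc => /eqP e; move/eqP: sum.
by rewrite e addrC (inj_eq (addIr _)) eq_sym.
Qed.

Lemma cut_A_swap A B C D Ps : cut_A A B C D Ps -> cut_A B A D C Ps.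
Proof.
case=> u1 [v1 [u2 [v2 [[h1 h2] [h3 h4] h5 h6]]]]; exists u1, v1, u2, v2.
rewrite (open_segmentC B) (open_segmentC D); split=> //.
by rewrite -(hull_swap A).
Qed.

Lemma cut_B_swap A B C D Ps : cut_B A B C D Ps -> cut_B B A D C Ps.
Proof.
case=> u1 [v1 [u2 [v2 [[h1 h2] h3 h4 h5]]]]; exists u1, v1, u2, v2.
rewrite (open_segmentC B A) (open_segmentC D C) (open_segmentC A D) (open_segmentC C B).
by split=> //; [case: h4 => ?; [right|left]|rewrite -(hull_swap A)].
Qed.

Lemma type_AP p Ps : type_A p Ps <->
  exists i, cut_A (p i) (p (i + 1)) (p (i + 2)) (p (i + 3)) Ps.
Proof.
have e i : i + 2 + 1 = i + 3 by case: (I4E i) => -[].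
rewrite /type_A /open_side; split=> -[i [u1 [v1 [u2 [v2 [h1 h2 h3 h4]]]]]];
  exists i.
  by exists u1, v1, u2, v2; rewrite hull_at; move: h1 h2; rewrite !e.
by exists u1, v1, u2, v2; rewrite !e; rewrite hull_at in h4.
Qed.

Lemma type_BP p Ps : type_B p Ps <->
  exists i, cut_B (p i) (p (i + 1)) (p (i + 2)) (p (i + 3)) Ps.
Proof.
have e i : [/\ i + 1 + 1 = i + 2, i + 2 + 1 = i + 3 & i + 3 + 1 = i].
  by case: (I4E i) => -[? ? ? ?] [].
rewrite /type_B /open_side; split=> -[i [u1 [v1 [u2 [v2 [h1 h2 h3 h4]]]]]];
  exists i; have [e1 e2 e3] := e i.
  exists u1, v1, u2, v2; rewrite hull_at; rewrite e2 in h1.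
  by rewrite e1 e3 in h3.
by exists u1, v1, u2, v2; rewrite e1 e2 e3; rewrite hull_at in h4.
Qed.

(** [Q[x,y]] has the areas [(x, 1, y, x + y - 1)], so proportional areas yield the affine map
    through [affine_map_exists]. *)
Lemma areas_affine_type p i e x y k :
  e = 1 \/ e = -1 -> k != 0 -> 
  areas (p i) (p (i + e)) (p (i + e *+ 2)) (p (i + e *+ 3)) =
    scale4 k (x, 1, y, x + y - 1) ->
  affine_type p x y.
Proof.
move=> he k0 ea; exists i, e.
have n0 : orient (p i) (p (i + e)) (p (i + e *+ 2)) != 0.
  by move: ea => -[_ -> _ _]; rewrite mulr1.
have e4 : areas (Defs.point 0 1) (Defs.point 0 0) (Defs.point 1 0) (Defs.point x y) =
    scale4 k^-1 (areas (p i) (p (i + e)) (p (i + e *+ 2)) (p (i + e *+ 3))).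
  by rewrite ea /areas /= !mulKf // !orientE !mxE /=; congr (_, _, _, _); ring.
have [M [b [MU hM]]] := affine_map_exists (invr_neq0 k0) n0 e4.
by exists M, b.
Qed.

Lemma affine_type_areas p x y : affine_type p x y ->
  exists i e k, [/\ e = 1 \/ e = -1, k != 0 &
  areas (p i) (p (i + e)) (p (i + e *+ 2)) (p (i + e *+ 3)) =
    scale4 k (x, 1, y, x + y - 1)].
Proof.
case=> i [e [M [b [he [MU [h1 h2 h3 h4]]]]]]; exists i, e.
have dM : \det M != 0 by rewrite -unitfE -unitmxE.
exists (\det M)^-1; split=> //; first by rewrite invr_eq0.
have := areas_affine M b (p i) (p (i + e)) (p (i + e *+ 2)) (p (i + e *+ 3)).
rewrite h1 h2 h3 h4 => -[e1 e2 e3 e4].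
have key (q o : R) : o = \det M * q -> q = (\det M)^-1 * o.
  by move=> ->; rewrite mulKf.
rewrite /areas /=; congr (_, _, _, _); apply: key;
  rewrite -?(e1, e2, e3, e4) !orientE !mxE /=; ring.
Qed.

(* The largest of the four areas can be brought into second position by a
   symmetry respecting the pair of opposite sides AB, CD, which then makes the
   quadrangle affinely equivalent to Q[x,y] with x, y < 1. *)
Lemma normal_form (T : R * R * R * R -> Prop) s A B C D :
  (forall k z, k != 0 -> T (scale4 k z) <-> T z) ->
  (forall a b c d, T (a, b, c, d) -> T (b, a, d, c)) ->
  (forall a b c d, T (a, b, c, d) -> T (d, c, b, a)) ->
  cvx s A B C D -> nondeg (areas A B C D) -> T (areas A B C D) ->
  exists A' B' C' D' x y k,
    [/\ (A', B', C', D') \in [:: (A, B, C, D); (B, A, D, C); (C, D, A, B); (D, C, B, A)],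
        areas A' B' C' D' = scale4 k (x, 1, y, x + y - 1), k != 0,
        T (x, 1, y, x + y - 1) & [/\ x < 1, y < 1 & 1 < x + y]].
Proof.
move=> Tscale Tswap Trev hc nd TQ.
have key A' B' C' D' s' : cvx s' A' B' C' D' -> T (areas A' B' C' D') ->
    s' * orient D' A' B' < s' * orient A' B' C' ->
    s' * orient B' C' D' < s' * orient A' B' C' ->
    exists x y k, [/\ areas A' B' C' D' = scale4 k (x, 1, y, x + y - 1), k != 0,
      T (x, 1, y, x + y - 1) & [/\ x < 1, y < 1 & 1 < x + y]].
  move=> hc' TA ab cb; have s0 := cvx_sign_neq0 hc'.
  case: hc' => a0 b0 c0 d0; have sum := areas_sum A' B' C' D'.
  have bn := gt0_neq0 b0.
  have eD : orient C' D' A' = orient D' A' B' + orient B' C' D' - orient A' B' C'.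
    by rewrite sum addrAC subrr add0r.
  have e : areas A' B' C' D' = scale4 (orient A' B' C')
      (orient D' A' B' / orient A' B' C', 1, orient B' C' D' / orient A' B' C',
       orient D' A' B' / orient A' B' C' + orient B' C' D' / orient A' B' C' - 1).
    rewrite /areas eD /=; congr (_, _, _, _); by field.
  exists (orient D' A' B' / orient A' B' C'), (orient B' C' D' / orient A' B' C'),
    (orient A' B' C').
  split=> //; first by rewrite e Tscale in TA.
  rewrite -(ratio_scale (orient D' _ _) _ s0) -(ratio_scale (orient B' _ _) _ s0).
  split; rewrite ?ltr_pdivrMr ?mul1r //.
  by rewrite -mulrDl ltr_pdivlMr // mul1r; move: d0; rewrite eD; lra.
have hcd : orient B C D != orient C D A by case/and5P: nd => _ _ _ _ /and3P[].
have had : orient D A B != orient C D A by case/and5P: nd => _ _ _ _ /and3P[].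
have sum := areas_sum A B C D; have s0 := cvx_sign_neq0 hc.
have ssum : s * orient D A B + s * orient B C D = s * orient A B C + s * orient C D A.
  by rewrite -!mulrDr sum.
have TS : T (areas B A D C).
  by rewrite areas_swap; apply/Tscale; rewrite ?oppr_eq0 ?oner_eq0 //; exact: Tswap.
have T2 : T (areas C D A B) by apply/Trev/Tswap.
have TR : T (areas D C B A).
  rewrite areas_swap.
  by apply/Tscale; rewrite ?oppr_eq0 ?oner_eq0 //; exact: Trev.
have hcS := cvx_swap hc; have hc2 := cvx_rot (cvx_rot hc); have hcR := cvx_rev hc.
have hcd' : s * orient B C D != s * orient C D A by rewrite (inj_eq (mulfI s0)).
have had' : s * orient D A B != s * orient C D A by rewrite (inj_eq (mulfI s0)).
have neg A1 B1 C1 : - s * orient C1 B1 A1 = s * orient A1 B1 C1.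
  by rewrite orientC mulrNN.
(* As the areas satisfy [a + c = b + d], comparing [c] and [a] with [d] also compares [b] with [a]
   and with [c]. Each of the four outcomes thus names the largest area. *)
have [cd|cd|] := ltgtP (s * orient B C D) (s * orient C D A); last by move/eqP; rewrite (negPf hcd').
  have [ad|ad|] := ltgtP (s * orient D A B) (s * orient C D A); last by move/eqP; rewrite (negPf had').
    have [|| x [y [k [e k0 Tx hxy]]]] := key C D A B s hc2 T2; [by []|by lra|].
    by exists C, D, A, B, x, y, k; split=> //; rewrite !inE eqxx ?orbT.
  have [|| x [y [k [e k0 Tx hxy]]]] := key B A D C (- s) hcS TS; rewrite ?neg; [lra|lra|].
  by exists B, A, D, C, x, y, k; split=> //; rewrite !inE eqxx ?orbT.
have [ad|ad|] := ltgtP (s * orient D A B) (s * orient C D A); last by move/eqP; rewrite (negPf had').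
  have [|| x [y [k [e k0 Tx hxy]]]] := key D C B A (- s) hcR TR; rewrite ?neg; [lra|lra|].
  by exists D, C, B, A, x, y, k; split=> //; rewrite !inE eqxx ?orbT.
have [|| x [y [k [e k0 Tx hxy]]]] := key A B C D s hc TQ; [lra|lra|].
by exists A, B, C, D, x, y, k; split=> //; rewrite !inE eqxx.
Qed.

End Quadrangle.

(** * Transfer between affine types and dissections, uniformly in the type of cut *)

Section Types.
Variable R : realType.
Implicit Types (A B C D : 'rV[R]_2) (p : 'I_4 -> 'rV[R]_2) (i j e : 'I_4).
Variables (cut : 'rV[R]_2 -> 'rV[R]_2 -> 'rV[R]_2 -> 'rV[R]_2 ->
                 seq (set 'rV[R]_2) -> Prop).
Variables (T : R * R * R * R -> Prop).
Hypothesis cut_swap : forall A B C D Ps, cut A B C D Ps -> cut B A D C Ps.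
Hypothesis cut_T : forall s A B C D, cvx s A B C D -> nondeg (areas A B C D) ->
  admits (cut A B C D) A B C D -> T (areas A B C D).
Hypothesis T_cut : forall s A B C D, cvx s A B C D -> nondeg (areas A B C D) ->
  T (areas A B C D) -> admits (cut A B C D) A B C D.
Hypothesis T_scale : forall k z, k != 0 -> T (scale4 k z) <-> T z.
Hypothesis T_swap : forall a b c d, T (a, b, c, d) -> T (b, a, d, c).
Hypothesis T_rev : forall a b c d, T (a, b, c, d) -> T (d, c, b, a).

(** These relabellings keep the pair of sides [AB], [CD]. Each amounts to a starting vertex and a
    direction, the mirror images having step -1. *)
Lemma labelling p i (Q : 'rV[R]_2 * 'rV[R]_2 * 'rV[R]_2 * 'rV[R]_2)
    (A := p i) (B := p (i + 1)) (C := p (i + 2)) (D := p (i + 3)) :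
  Q \in [:: (A, B, C, D); (B, A, D, C); (C, D, A, B); (D, C, B, A)] ->
  exists j e, (e = 1 \/ e = -1) /\
    Q = (p j, p (j + e), p (j + e *+ 2), p (j + e *+ 3)).
Proof.
case: (I4E i) => -[e1 e2 e3 e4] [e5 e6 e7].
rewrite !inE => /or4P[]/eqP ->.
- by exists i, 1; split; [left|].
- exists (i + 1), (-1); split; first by right.
  rewrite addrK; congr (_, _, p _, p _); rewrite -addrA; congr (_ + _); exact: val_inj.
- exists (i + 2), 1; split; first by left.
  by rewrite e4 e5 e6.
- exists (i + 3), (-1); split; first by right.
  congr (_, p _, p _, p _); rewrite -?addrA; try by congr (_ + _); exact: val_inj.
  by rewrite -[LHS]addr0; congr (_ + _); exact: val_inj.
Qed.

Lemma ratios_of_type p Ps i : convex_quadrangle p -> ~ trapezoid p ->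
  self_affinity 3 (region p) Ps ->
  cut (p i) (p (i + 1)) (p (i + 2)) (p (i + 3)) Ps ->
  exists x y : R, affine_type p x y /\ [/\ x < 1, y < 1, 1 < x + y &
     T (x, 1, y, x + y - 1)].
Proof.
move=> hconv ht sa hcut; have [s hc] := cvx_at i hconv.
have nd := nondeg_at i hconv ht.
have TQ : T (areas (p i) (p (i + 1)) (p (i + 2)) (p (i + 3))).
  by apply: (cut_T hc nd); exists Ps; rewrite hull_at.
have [A [B [C [D [x [y [k [hQ e k0 Tx [x1 y1 xy1]]]]]]]]] :=
  normal_form T_scale T_swap T_rev hc nd TQ.
exists x, y; split=> //.
have [j [d [hd [eA eB eC eD]]]] := labelling hQ.
by apply: (areas_affine_type (i := j) hd k0); rewrite -eA -eB -eC -eD e.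
Qed.

Lemma type_of_ratios p (x y : R) : convex_quadrangle p -> ~ trapezoid p ->
  affine_type p x y -> T (x, 1, y, x + y - 1) ->
  exists Ps, self_affinity 3 (region p) Ps /\
     exists i, cut (p i) (p (i + 1)) (p (i + 2)) (p (i + 3)) Ps.
Proof.
move=> hconv ht /affine_type_areas[i [e [k [he k0 ea]]]] Tx.
have TQ : T (areas (p i) (p (i + e)) (p (i + e *+ 2)) (p (i + e *+ 3))).
  by rewrite ea; apply/T_scale.
case: he => he; subst e.
  have [s hc] := cvx_at i hconv; have nd := nondeg_at i hconv ht.
  have [Ps [sa hcut]] := T_cut hc nd TQ.
  by exists Ps; rewrite -(hull_at p i); split=> //; exists i.
(* The backward labelling from [p i] is the mirror image [B A D C] of the forward one from
   [p (i - 1)], and [i - 1 = i + 3]. *)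
pose j := i + 3.
have [s hc] := cvx_at j hconv; have nd := nondeg_at j hconv ht.
case: (I4E i) => -[e1 e2 e3 e4] [e5 e6 e7].
have ej : [/\ j + 1 = i, i + (-1) = j, i + (-1) *+ 2 = j + 3 & i + (-1) *+ 3 = j + 2].
  rewrite /j -!addrA; split; try by congr (_ + _); exact: val_inj.
  by rewrite -[RHS]addr0; congr (_ + _); exact: val_inj.
case: ej => j1 j2 j3 j4; rewrite j2 j3 j4 -{1}j1 in TQ.
have [Ps [sa hcut]] := T_cut (cvx_swap hc) (nondeg_swap nd) TQ.
exists Ps; split; first by rewrite -(hull_at p j) hull_swap.
by exists j; apply: cut_swap.
Qed.

End Types.

Theorem theorem4 (R : realType) (p : 'I_4 -> 'rV[R]_2)
    (hconv : convex_quadrangle p) (hntrap : ~ trapezoid p) :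
  ((exists Ps : seq (set 'rV[R]_2),
      self_affinity 3 (region p) Ps /\ type_A p Ps) <->
   (exists x y : R, affine_type p x y /\ curve_A (x, y))) /\
  ((exists Ps : seq (set 'rV[R]_2),
      self_affinity 3 (region p) Ps /\ type_B p Ps) <->
   (exists x y : R, affine_type p x y /\
      (curve_B1 (x, y) \/ curve_B2 (x, y)))).
Proof.
split; split.
- case=> Ps [sa /type_AP[i hcut]].
  have [x [y [hxy [x1 y1 xy1 Tx]]]] := ratios_of_type (@cut_A_ratios R)
    (@ratios_A_scale R) (@ratios_A_swap R) (@ratios_A_rev R) hconv hntrap sa hcut.
  by exists x, y; split=> //; apply/ratios_A_normal.
(* The bound [x < 1] of the normal form comes from [x < y] and [y < 1]. *)
- case=> x [y [hxy hA]]; have [xy1 y1 xy _] := hA.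
  have /ratios_A_normal Tx := hA.
  have [Ps [sa hcut]] := type_of_ratios (@cut_A_swap R) (@ratios_cut_A R)
    (@ratios_A_scale R) hconv hntrap hxy (Tx (lt_trans xy y1) y1 xy1).
  by exists Ps; split=> //; apply/type_AP.
- case=> Ps [sa /type_BP[i hcut]].
  have [x [y [hxy [x1 y1 xy1 Tx]]]] := ratios_of_type (@cut_B_ratios R)
    (@ratios_B_scale R) (@ratios_B_swap R) (@ratios_B_rev R) hconv hntrap sa hcut.
  by exists x, y; split=> //; apply: ratios_B_curve.
case=> x [y [hxy hB]].
have [xy1 y1 xy] : [/\ 1 < x + y, y < 1 & x < y] by case: hB => -[].
have Tx := curve_ratios_B (lt_trans xy y1) y1 xy1 hB.
have [Ps [sa hcut]] := type_of_ratios (@cut_B_swap R) (@ratios_cut_B R)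
  (@ratios_B_scale R) hconv hntrap hxy Tx.
by exists Ps; split=> //; apply/type_BP.
Qed.
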